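(* Let $X$ be a Cantor space and let $K$ be a dynamical simplex on $X$. There exists a comeager conjugacy class in $G_K^*$ if, and only if, $K$ is a singleton $\{\mu\}$ and $\mu$ is the unique invariant Borel probability measure of some odometer $g$ on $X$. In that case, the conjugacy class of $g$ is comeager in $G_K^*$.
   Context: $X$ is a Cantor space and $\mathrm{Clopen}(X)$ is the set of its clopen subsets. A dynamical simplex on $X$ is a nonempty compact (for the weak-* topology) convex set $K$ of Borel probability measures on $X$ such that: (i) every $\mu\in K$ is atomless and has full support; (ii) for all $A,B\in\mathrm{Clopen}(X)$ with $\mu(A)<\mu(B)$ for all $\mu\in K$, there is a clopen $\tilde A\subseteq B$ with $\mu(\tilde A)=\mu(A)$ for all $\mu\in K$. $G_K=\{g\in \mathrm{Homeo}(X): g_*\mu=\mu \text{ for all }\mu\in K\}$, where $g_*\mu(A)=\mu(g^{-1}A)$. It is a Polish group for the topology in which a neighborhood basis of the identity is given by the subgroups $\{g\in G_K: g(A)=A \text{ for all } A\in\mathcal A\}$, where $\mathcal A$ ranges over all (finite) clopen partitions of $X$. $G_K^*$ is the set of all $g\in G_K$ such that $g(U)\ne U$ for every clopen $U$ with $U\neq\emptyset$, $U\ne X$; it is a closed subset of $G_K$ and is given the subspace topology. $G_K$ acts on $G_K^*$ by conjugation; a conjugacy class in $G_K^*$ is an orbit $\{hgh^{-1}: h\in G_K\}$ ($g\in G_K^*$) of this action. Odometers: given a sequence $\bar k=(k_i)_{i\ge 0}$ of integers $\ge 2$, let $Y_{\bar k}=\prod_{i=0}^{\infty}\{0,\ldots,k_i-1\}$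 (a Cantor space) and let $T_{\bar k}:Y_{\bar k}\to Y_{\bar k}$ be ''adding $1$ with right-carry'': if $y(i)<k_i-1$ for some $i$, take the smallest such $i$ and let $T_{\bar k}(y)$ be the sequence whose first $i$ entries are $0$, whose $i$-th entry is $y(i)+1$, and which agrees with $y$ at all later indices; if there is no such $i$, let $T_{\bar k}(y)$ be the constant sequence $0$. A map $g:X\to X$ is an odometer if there are a sequence $\bar k=(k_i)_{i\ge 0}$ of integers $\ge 2$ and a homeomorphism $h:Y_{\bar k}\to X$ with $g=hT_{\bar k}h^{-1}$. Every odometer has a unique invariant Borel probability measure. *)

(* Defs.v *)
From HB Require Import structures.
From mathcomp Require Import all_boot all_order all_algebra.
From mathcomp Require Import all_classical all_reals all_analysis.
From mathcomp Require Import giry.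
Set Implicit Arguments.
Unset Strict Implicit.
Unset Printing Implicit Defensive.
Import Order.TTheory GRing.Theory Num.Theory.
Import numFieldTopology.Exports.
Local Open Scope classical_set_scope.
Local Open Scope ring_scope.

(** ** Homeomorphisms and Cantor spaces *)

Record homeo (S T : topologicalType) := Homeo {
  homeo_fun :> S -> T;
  homeo_inv : T -> S;
  homeoK : cancel homeo_fun homeo_inv;
  homeoVK : cancel homeo_inv homeo_fun;
  homeo_cont : continuous homeo_fun;
  homeoV_cont : continuous homeo_inv
}.
Arguments homeo_cont {S T} h : rename.
Arguments homeoV_cont {S T} h : rename.

Definition is_cantor_space (X : topologicalType) : Prop :=
  inhabited (homeo cantor_space X).

Lemma homeo_eq (S T : topologicalType) (f g : homeo S T) :
  (f : S -> T) =1 g -> f = g.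
Proof.
case: f g => [f f' fK f'K fc f'c] [g g' gK g'K gc g'c] /= fg.
have fgE : f = g by exact/funext.
rewrite {}fgE in fK f'K fc fg *.
have fgE' : f' = g' by apply/funext => t; rewrite -{1}(g'K t) fK.
rewrite {}fgE' in fK f'K f'c *.
by congr Homeo; exact: Prop_irrelevance.
Qed.

Lemma homeo_id_cont (X : topologicalType) : continuous (@id X).
Proof. by move=> x; exact: cvg_id. Qed.

Definition homeo_id (X : topologicalType) : homeo X X :=
  Homeo (fun=> erefl) (fun=> erefl) (@homeo_id_cont X) (@homeo_id_cont X).

Definition homeo_sym (S T : topologicalType) (f : homeo S T) : homeo T S :=
  Homeo (homeoVK f) (homeoK f) (homeoV_cont f) (homeo_cont f).

Lemma homeo_comp_cont (S T U : topologicalType) (f : T -> U) (g : S -> T) :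
  continuous f -> continuous g -> continuous (f \o g).
Proof. by move=> fc gc x; apply: continuous_comp; [exact: gc|exact: fc]. Qed.

Definition homeo_comp (S T U : topologicalType) (f : homeo T U)
    (g : homeo S T) : homeo S U :=
  Homeo (can_comp (homeoK f) (homeoK g)) (can_comp (homeoVK g) (homeoVK f))
    (homeo_comp_cont (homeo_cont f) (homeo_cont g))
    (homeo_comp_cont (homeoV_cont g) (homeoV_cont f)).

(** ** Borel probability measures *)

Notation borel X := (g_sigma_algebraType (@open X)).

(* Library measures are functions on all subsets, whose values on
   non-measurable sets are unconstrained; hence two of them are the same Borel
   measure iff they are related by [measure_eq], not iff they are Leibniz equal. *)

Definition invariant_measure (R : realType) (X : ptopologicalType) (g : X -> X)
    (mu : probability (borel X) R) : Prop :=
  forall A : set (borel X), measurable A ->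
    pushforward mu (g : borel X -> borel X) A = mu A.

Definition unique_invariant_measure (R : realType) (X : ptopologicalType)
    (g : X -> X) (mu : probability (borel X) R) : Prop :=
  invariant_measure g mu /\
  forall nu : probability (borel X) R, invariant_measure g nu -> measure_eq nu mu.

Definition integral_eval (R : realType) (X : ptopologicalType)
    (mu : probability (borel X) R) :
    prod_topology (fun _ : continuousType X R => R) :=
  fun f => \int[mu]_x (f : X -> R) x.

(* The weak-* topology: the coarsest one making every mu |-> \int f dmu, for f
   continuous, continuous (for X compact). *)
Definition weak_star (R : realType) (X : ptopologicalType) : topologicalType :=
  initial_topology (@integral_eval R X).

(** ** Dynamical simplices *)

(* A convex combination is determined on Borel sets only; with the universal
   quantifier over [rho], K contains every representative of its elements. *)
Definition convex_measures (R : realType) (X : ptopologicalType)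
    (K : set (probability (borel X) R)) : Prop :=
  forall (mu nu rho : probability (borel X) R) (t : R),
    K mu -> K nu -> 0 <= t <= 1 ->
    (forall A, measurable A ->
      rho A = t%:E * mu A + (1 - t)%:E * nu A)%E ->
    K rho.

Definition atomless (R : realType) (X : ptopologicalType)
    (mu : probability (borel X) R) : Prop :=
  forall x : X, mu [set x] = 0%E.

Definition full_support (R : realType) (X : ptopologicalType)
    (mu : probability (borel X) R) : Prop :=
  forall U : set X, open U -> U !=set0 -> (0 < mu U)%E.

Record dynamical_simplex (R : realType) (X : ptopologicalType)
    (K : set (probability (borel X) R)) : Prop := DynamicalSimplex {
  simplex_nonempty : K !=set0;
  simplex_compact : compact (K : set (weak_star R X));
  simplex_convex : convex_measures K;
  simplex_regular : forall mu, K mu -> atomless mu /\ full_support mu;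
  simplex_subsets : forall A B : set X, clopen A -> clopen B ->
    (forall mu, K mu -> (mu A < mu B)%E) ->
    exists A' : set X,
      [/\ clopen A', A' `<=` B & forall mu, K mu -> mu A' = mu A]
}.

(** ** The Polish group [G_K] *)

Record GK (R : realType) (X : ptopologicalType)
    (K : set (probability (borel X) R)) := MkGK {
  GK_homeo :> homeo X X;
  GK_invariant : forall mu, K mu -> invariant_measure GK_homeo mu
}.

Section GK_group.
Context (R : realType) (X : ptopologicalType)
  (K : set (probability (borel X) R)).
Implicit Types f g h : GK K.

HB.instance Definition _ := gen_eqMixin (GK K).
HB.instance Definition _ := gen_choiceMixin (GK K).

Lemma GK_eq f g : (f : X -> X) =1 g -> f = g.
Proof.
case: f g => [f fi] [g gi] /= /homeo_eq fg.
by rewrite {}fg in fi *; congr MkGK; exact: Prop_irrelevance.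
Qed.

Lemma homeo_measurable (f : homeo X X) (A : set (borel X)) :
  measurable A -> measurable (f @^-1` A : set (borel X)).
Proof.
move=> mA; rewrite -[X in measurable X]setTI.
have mf : measurable_fun [set: borel X] (f : borel X -> borel X).
  apply: (@measurability _ _ (borel X) (borel X) setT f (@open X)) => //.
  move=> _ [B oB <-]; rewrite setTI; apply: sub_sigma_algebra.
  by move/continuousP: (@homeo_cont _ _ f); apply.
exact: mf.
Qed.

Lemma GK_id_subproof mu : K mu -> invariant_measure (homeo_id X) mu.
Proof. by []. Qed.

Lemma GK_comp_subproof f g mu : K mu -> invariant_measure (homeo_comp f g) mu.
Proof.
move=> Kmu A mA; rewrite -(GK_invariant f Kmu mA).
exact: (GK_invariant g Kmu (homeo_measurable f mA)).
Qed.

Lemma GK_inv_subproof f mu : K mu -> invariant_measure (homeo_sym f) mu.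
Proof.
move=> Kmu A mA.
apply: (etrans (esym (GK_invariant f Kmu (homeo_measurable (homeo_sym f) mA)))).
rewrite /pushforward; congr (mu _).
by apply/seteqP; split=> x /=; rewrite homeoK.
Qed.

Definition GK_one : GK K := MkGK GK_id_subproof.
Definition GK_mul f g : GK K := MkGK (GK_comp_subproof f g).
Definition GK_inv f : GK K := MkGK (GK_inv_subproof f).

Lemma GK_mulA : associative GK_mul. Proof. by move=> f g h; exact: GK_eq. Qed.
Lemma GK_mul1 : left_id GK_one GK_mul. Proof. by move=> f; exact: GK_eq. Qed.
Lemma GK_mulV : left_inverse GK_one GK_inv GK_mul.
Proof. by move=> f; apply: GK_eq => x /=; rewrite homeoK. Qed.
Lemma GK_mul1r : right_id GK_one GK_mul. Proof. by move=> f; exact: GK_eq. Qed.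
Lemma GK_mulVr : right_inverse GK_one GK_inv GK_mul.
Proof. by move=> f; apply: GK_eq => x /=; rewrite homeoVK. Qed.

HB.instance Definition _ :=
  isGroup.Build (GK K) GK_mulA GK_mul1 GK_mul1r GK_mulV GK_mulVr.
End GK_group.

Definition clopen_partition (X : topologicalType) (P : set (set X)) : Prop :=
  [/\ finite_set P, partition P id [set: X] & forall A, P A -> clopen A].

Section GK_topology.
Context (R : realType) (X : ptopologicalType)
  (K : set (probability (borel X) R)).
Local Open Scope group_scope.

Definition stab (P : set (set X)) : set (GK K) :=
  [set g : GK K | forall A, P A -> g @` A = A].

Definition GK_open : set (set (GK K)) :=
  [set O | forall g, O g -> exists2 P, clopen_partition P &
    [set g * u | u in stab P] `<=` O].

Definition refinement (P Q : set (set X)) : set (set X) :=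
  [set C | C !=set0 /\ exists A B, [/\ P A, Q B & C = A `&` B]].

Lemma refinement_partition P Q : clopen_partition P -> clopen_partition Q ->
  clopen_partition (refinement P Q).
Proof.
move=> [finP [cP tP nP] oP] [finQ [cQ tQ nQ] oQ]; split.
- apply: (@sub_finite_set _ _ [set A `&` B | A in P & B in Q]).
    by move=> _ [_ [A [B [PA QB ->]]]]; exists A => //; exists B.
  exact: finite_image2.
- split.
  + rewrite -subTset => x _.
    have [A PA Ax] : cover P id x by rewrite cP.
    have [B QB Bx] : cover Q id x by rewrite cQ.
    by exists (A `&` B) => //; split; [exists x|exists A, B].
  + move=> _ _ [_ [A [B [PA QB ->]]]] [_ [A' [B' [PA' QB' ->]]]].
    move=> [x [[Ax Bx] [A'x B'x]]].
    by rewrite (tP A A') //; [rewrite (tQ B B') //; exists x|exists x].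
  + by move=> C [].
- by move=> _ [_ [A [B [/oP cA /oQ cB ->]]]]; exact: clopenI.
Qed.

Lemma stab_refinementl P Q : clopen_partition P -> clopen_partition Q ->
  stab (refinement P Q) `<=` stab P.
Proof.
move=> cP [_ [cQ _ _] _] g gPQ A PA.
have AE x : A x -> exists B, refinement P Q B /\ B x /\ B `<=` A.
  move=> Ax; have [B QB Bx] : cover Q id x by rewrite cQ.
  by exists (A `&` B); split; [split; [exists x|exists A, B]|split=> // y []].
apply/seteqP; split=> [_ [x /AE[B [rB [Bx BA]]] <-]|y /AE[B [rB [By BA]]]].
  by apply: BA; rewrite -(gPQ B rB); exists x.
by move: By; rewrite -{1}(gPQ B rB) => -[x /BA Ax <-]; exists x.
Qed.

Lemma refinementC P Q : refinement P Q = refinement Q P.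
Proof.
by apply/seteqP; split=> C [C0 [A [B [PA QB CE]]]]; split=> //;
  by exists B, A; rewrite setIC.
Qed.

Lemma GK_openT : GK_open setT.
Proof.
move=> g _; exists [set [set: X]] => //; split; first exact: finite_set1.
  split; first by rewrite /cover bigcup_set1.
    by move=> _ _ -> ->.
  by move=> _ ->; exists point.
by move=> _ ->; exact: clopenT.
Qed.

Lemma GK_openI : setI_closed GK_open.
Proof.
move=> O1 O2 o1 o2 g [/o1[P cP sP] /o2[Q cQ sQ]].
exists (refinement P Q); first exact: refinement_partition.
move=> _ [u su <-]; split.
  by apply: sP; exists u => //; exact: stab_refinementl su.
by apply: sQ; exists u => //; move: su; rewrite refinementC; exact: stab_refinementl.
Qed.

Lemma GK_open_bigU (I : Type) (f : I -> set (GK K)) :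
  (forall i, GK_open (f i)) -> GK_open (\bigcup_i f i).
Proof.
move=> fo g [i _ /fo[P cP sP]]; exists P => // h /sP fh.
by exists i.
Qed.

HB.instance Definition _ :=
  isOpenTopological.Build (GK K) GK_openT GK_openI GK_open_bigU.

Lemma nbhs_GKP (g : GK K) (U : set (GK K)) :
  nbhs g U <-> exists2 P, clopen_partition P &
    [set g * u | u in stab P] `<=` U.
Proof.
split.
  rewrite nbhsE => -[V [oV Vg] VU]; have [P cP sP] := oV _ Vg.
  by exists P => //; exact: subset_trans VU.
move=> [P cP sP]; rewrite nbhsE; exists [set g * u | u in stab P] => //; split.
  move=> _ [u su <-]; exists P => // _ [v sv <-]; exists (u * v).
    by move=> A PA; rewrite -[LHS]/((u \o v) @` A) -image_comp sv // su.
  by rewrite mulgA.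
exists 1; last by rewrite mulg1.
by move=> A _; rewrite image_id.
Qed.
End GK_topology.

(* As a type, [GKstar K] carries the subspace topology. *)
Definition GKstar (R : realType) (X : ptopologicalType)
    (K : set (probability (borel X) R)) : set (GK K) :=
  [set g : GK K | forall U : set X, clopen U -> U !=set0 -> U <> setT -> g @` U <> U].
Arguments GKstar {R X} K.

Definition conj_class (R : realType) (X : ptopologicalType)
    (K : set (probability (borel X) R)) (g : GKstar K) : set (GKstar K) :=
  [set f : GKstar K | exists h : GK K, val f = (h * val g * h^-1)%g].

(** ** Baire category *)

Definition nowhere_dense (T : topologicalType) (A : set T) : Prop :=
  interior (closure A) = set0.

Definition meager (T : topologicalType) (A : set T) : Prop :=
  exists F : nat -> set T,
    (forall n, nowhere_dense (F n)) /\ A = \bigcup_n F n.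

Definition comeager (T : topologicalType) (A : set T) : Prop := meager (~` A).

(** ** Odometers *)

Definition odometer_space (k : nat -> nat) : topologicalType :=
  prod_topology (fun i => discrete_topology 'I_(k i)).

Definition ord_zero n (i : 'I_n) : 'I_n :=
  Ordinal (leq_ltn_trans (leq0n i) (ltn_ord i)).

(* [ordS] is the cyclic successor of ['I_n]; it is only applied below its
   maximum, where it adds 1. *)
Definition add_one (k : nat -> nat) (y : odometer_space k) : odometer_space k :=
  if pselect (exists i, (y i < (k i).-1)%N) is left ex_i then
    fun j => if (j < ex_minn ex_i)%N then ord_zero (y j)
             else if j == ex_minn ex_i then ordS (y j)
             else y j
  else fun j => ord_zero (y j).

Definition is_odometer (X : topologicalType) (g : X -> X) : Prop :=
  exists2 k : nat -> nat, (forall i, 2 <= k i)%N &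
  exists h : homeo (odometer_space k) X, g = h \o @add_one k \o homeo_inv h.

(* Main.v *)
Require Import Defs.
From mathcomp Require Import all_boot all_order all_algebra all_fingroup.
From mathcomp Require Import all_classical all_reals all_analysis.
From mathcomp Require Import giry zify.
Set Implicit Arguments.
Unset Strict Implicit.
Unset Printing Implicit Defensive.
Import Order.TTheory GRing.Theory Num.Theory.
Local Open Scope classical_set_scope.

(** Why the theorem holds.

    Everything is read in coordinates ([coords]): compatible locally constant
    maps from [X] onto the sets of residues modulo [N l], which separate points.
    The Cantor space has such coordinates with [N l = 2 ^ l]; an odometer is a
    map that adds 1 in suitable coordinates ([steps]).

    From odometers to comeager classes.  Let [K] consist of the unique invariant
    measure of an odometer [g]; every cell of level [l] then has mass [1 / N l].
    A map [f] without invariant clopen sets is conjugate to [g] as soon as some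
    power of [f] fixes all cells of level [l], for each [l]: the phases of the
    resulting periodic itineraries are coordinates in which [f] adds 1
    ([periodic_coords]), the masses of cells show that the moduli of these
    coordinates and of those of [g] are cofinal for divisibility, and equal
    moduli give conjugate maps ([steps_conj_class]).  So the class is cut out by
    countably many open conditions.  It is also dense ([conj_dense]): draw an
    edge for each cell of a fine level, from the name of its preimage under [f]
    to its own name.  As [f] preserves the measure this graph is balanced, as [f]
    has no invariant clopen set it is connected, and an Eulerian circuit tells in
    which order a conjugate of [g] should visit the cells in order to
    approximate [f].

    From comeager classes to odometers.  Let the class of [g] be comeager and let
    [A] be clopen.  There are countably many clopen sets, and the space of maps
    without invariant clopen sets is a Baire space ([GKstar_baire]); hence, for
    some clopen [B], the conjugates of [g] by maps taking [A] to [B] are dense in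
    some nonempty open set [V].  The frequency of every pattern of visits to [B]
    is then the same for all members of [V].  Let [f] be one of the conjugates
    in [V], and refine the partition defining [V] until it also determines [B].
    If two consecutive return words of an orbit to a cell of the refined
    partition did not commute, say [u v <> v u], recurrence would produce an
    orbit segment along which [u v] occurs many times.  Permuting the return
    words of that segment, on a thin tower around it, conjugates [f] to other
    members of [V]: in one of them the tower reads [u v u v ... u v], in another
    one [u ... u v ... v], and the pattern [u v u v] is more frequent in the
    first ([rearrangement_count]).  So return words commute
    ([return_words_commute]), which makes visits to [B] periodic along every
    orbit, with a common period ([constant_patterns_periodic]).  Therefore each
    clopen [A] is fixed by a power of [g], and [g] is an odometer by
    [periodic_coords]; it is uniquely ergodic, so [K] reduces to one measure. *)

(** * Coordinates on zero-dimensional compact spaces *)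

(** Such coordinates identify a compact space with the inverse limit of the groups
    of integers modulo [N l].  Cantor spaces and odometer spaces both carry them,
    so that a single theory of cells, clopen sets and continuity serves both. *)
Record coords (T : topologicalType) (N : nat -> nat) (c : nat -> T -> nat) :
    Prop := Coords {
  co_lt : forall l x, c l x < N l;
  co_open : forall l i, open [set x | c l x = i];
  co_mod : forall l x, c l x = c l.+1 x %% N l;
  co_sep : forall x y, (forall l, c l x = c l y) -> x = y;
  co_onto : forall l i, i < N l -> exists x, c l x = i;
  co_dvd : forall l, N l %| N l.+1
}.

Section Coords.
Context (T : topologicalType) (N : nat -> nat) (c : nat -> T -> nat).
Hypotheses (cpt : compact [set: T]) (co : coords N c).

Lemma co_dvd_le l m : l <= m -> N l %| N m.
Proof.
move=> /subnK <-; elim: (m - l) => // k IH.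
by rewrite addSn; apply: dvdn_trans IH (co_dvd co _).
Qed.

Lemma co_mod_le l m x : l <= m -> c l x = c m x %% N l.
Proof.
move=> /subnK <-; elim: (m - l) => [|k IH]; first by rewrite modn_small ?(co_lt co).
by rewrite addSn IH (co_mod co (k + l)) modn_dvdm // co_dvd_le // leq_addl.
Qed.

Lemma co_coarse l m x y : l <= m -> c m x = c m y -> c l x = c l y.
Proof. by move=> lm e; rewrite !(co_mod_le _ lm) e. Qed.

Lemma co_nbhs_cell l (x : T) : nbhs x [set y | c l y = c l x].
Proof. by apply: open_nbhs_nbhs; split; [exact: (co_open co)|]. Qed.

Lemma co_cluster (x : nat -> T) :
  exists z : T, forall l V, nbhs z V -> exists2 m, l <= m & V (x m).
Proof.
have [z [_ zcl]] := cpt (fmap_proper_filter x eventually_filter) filterT.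
exists z => l V zV.
have [|_ [[m lm <-] e]] := zcl (x @` [set m | l <= m]) V _ zV; last by exists m.
by exists l => // m /= lm; exists m.
Qed.

(** Cells form a base: counterexamples at finer and finer levels would cluster at
    a point with the coordinates of [x]. *)
Lemma co_nbhs (x : T) (U : set T) :
  nbhs x U <-> exists l, forall y, c l y = c l x -> U y.
Proof.
split=> [xU|[l lU]]; last by apply: filterS lU _; exact: co_nbhs_cell.
apply: contrapT => /forallNP noL.
have /choice[y yP] : forall l, exists y, c l y = c l x /\ ~ U y.
  by move=> l; have /existsNP[y /not_implyP[]] := noL l; exists y.
have [z zP] := co_cluster y.
have zx : z = x.
  apply: (co_sep co) => l; have [m lm <-] := zP l _ (co_nbhs_cell l z).
  by apply: (co_coarse lm); case: (yP m).
rewrite -zx in xU; have [m _] := zP 0 _ xU.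
by case: (yP m).
Qed.

(** Otherwise pairs that agree at level [l] but are told apart by [q] would
    cluster, as [l] grows, at a point around which [q] is constant. *)
Lemma co_uniform (Q : Type) (q : T -> Q) :
  (forall x, nbhs x [set y | q y = q x]) ->
  exists l, forall x y, c l x = c l y -> q x = q y.
Proof.
move=> lq; apply: contrapT => /forallNP noL.
have /choice[p pP] : forall l, exists p : T * T,
    c l p.1 = c l p.2 /\ q p.1 <> q p.2.
  move=> l; have /existsNP[x /existsNP[y /not_implyP[]]] := noL l.
  by exists (x, y).
have [z zP] := co_cluster (fun l => (p l).1).
have /co_nbhs[l0 l0P] := lq z.
have [m lm] := zP l0 _ (co_nbhs_cell l0 z).
move=> e; case: (pP m) => e'; apply.
by rewrite (l0P _ e) l0P // -e; apply/esym; exact: (co_coarse lm).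
Qed.

Lemma co_clopen (A : set T) : clopen A <->
  exists l, forall x y, c l x = c l y -> A x -> A y.
Proof.
split=> [[oA cA]|[l lA]].
  have [|l lP] := @co_uniform Prop A.
    move=> x; have [Ax|nAx] := pselect (A x).
      have : nbhs x A by apply: open_nbhs_nbhs.
      by apply: filterS => y Ay /=; apply/propext.
    have : nbhs x (~` A) by apply: open_nbhs_nbhs; split => //; exact: closed_openC.
    by apply: filterS => y Ay /=; apply/propext.
  by exists l => x y /lP ->.
split; last rewrite -openC; rewrite openE => x Ax.
- by apply/co_nbhs; exists l => y e; apply: lA Ax.
- by apply/co_nbhs; exists l => y e Ay; apply: Ax; exact: lA Ay.
Qed.

Lemma co_clopen_cell l i : clopen [set x | c l x = i].
Proof. by apply/co_clopen; exists l => x y /= ->. Qed.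

Lemma co_onto_seq (s : nat -> nat) :
  (forall l, s l < N l) -> (forall l, s l = s l.+1 %% N l) ->
  exists x, forall l, c l x = s l.
Proof.
move=> sN smod.
have sle l m : l <= m -> s l = s m %% N l.
  move=> /subnK <-; elim: (m - l) => [|k IH]; first by rewrite modn_small.
  by rewrite addSn IH (smod (k + l)) modn_dvdm // co_dvd_le // leq_addl.
have /choice[x xP] : forall l, exists x, c l x = s l.
  by move=> l; exact: (co_onto co).
have [z zP] := co_cluster x.
exists z => l; have [m lm <-] := zP l _ (co_nbhs_cell l z).
by rewrite (co_mod_le _ lm) xP -sle.
Qed.

Lemma co_continuous (S : topologicalType) (f : S -> T) :
  (forall l x, nbhs x [set y | c l (f y) = c l (f x)]) -> continuous f.
Proof.
move=> fc x U /co_nbhs[l lU]; apply: filterS (fc l x) => y /= e.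
exact: lU.
Qed.

Lemma co_continuous_uniform (f : T -> T) : continuous f ->
  forall l, exists m, forall x y, c m x = c m y -> c l (f x) = c l (f y).
Proof.
move=> fc l; apply: co_uniform => x.
exact: (fc x _ (co_nbhs_cell l (f x))).
Qed.
End Coords.

(** Both spaces are the same inverse limit. *)
Lemma co_homeo (S T : topologicalType) N (c : nat -> S -> nat) (d : nat -> T -> nat) :
  compact [set: S] -> compact [set: T] -> coords N c -> coords N d ->
  exists h : homeo S T, forall l x, d l (h x) = c l x.
Proof.
move=> cS cT cc cd.
have /choice[h hP] : forall x, exists y, forall l, d l y = c l x.
  move=> x; apply: (co_onto_seq cT cd) => l; [exact: (co_lt cc)|exact: (co_mod cc)].
have /choice[g gP] : forall x, exists y, forall l, c l y = d l x.
  move=> x; apply: (co_onto_seq cS cc) => l; [exact: (co_lt cd)|exact: (co_mod cd)].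
have hg : cancel h g by move=> x; apply: (co_sep cc) => l; rewrite gP.
have gh : cancel g h by move=> x; apply: (co_sep cd) => l; rewrite hP.
have hc : continuous h.
  apply: (co_continuous cT cd) => l x; under eq_set => y do rewrite !hP.
  exact: (co_nbhs_cell cc).
have gc : continuous g.
  apply: (co_continuous cS cc) => l x; under eq_set => y do rewrite !gP.
  exact: (co_nbhs_cell cd).
by exists (Homeo hg gh hc gc).
Qed.

Lemma coords_homeo (S T : topologicalType) N (c : nat -> S -> nat)
    (h : homeo S T) : coords N c -> coords N (fun l => c l \o homeo_inv h).
Proof.
case=> clt cop cmod csep cont cdvd; split => //=.
- move=> l i; have /continuousP hc := homeoV_cont h.
  exact: hc _ (cop l i).
- by move=> x y e; apply: (can_inj (homeoVK h)); exact: csep.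
- by move=> l i /cont[x <-]; exists (h x); rewrite homeoK.
Qed.

Lemma homeo_compact (S T : topologicalType) (h : homeo S T) :
  compact [set: S] -> compact [set: T].
Proof.
move=> cS; have -> : [set: T] = h @` [set: S].
  by apply/seteqP; split=> // y _; exists (homeo_inv h y) => //; rewrite homeoVK.
by apply: continuous_compact => //; apply: continuous_subspaceT; exact: homeo_cont.
Qed.

Lemma homeo_clopen (S T : topologicalType) (f : homeo S T) (A : set T) :
  clopen A -> clopen (f @^-1` A).
Proof.
move=> [oA cA]; split; first by have /continuousP := homeo_cont f; apply.
by apply: closed_comp => // x _; exact: homeo_cont.
Qed.

(** * Mixed-radix digits, Cantor spaces and odometers *)

Definition radix (k : nat -> nat) l := \prod_(i < l) k i.
Definition radix_val (k s : nat -> nat) l := \sum_(i < l) s i * radix k i.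

Lemma radix0 k : radix k 0 = 1. Proof. by rewrite /radix big_ord0. Qed.
Lemma radixS k l : radix k l.+1 = radix k l * k l.
Proof. by rewrite /radix big_ord_recr. Qed.
Lemma radix_val0 k s : radix_val k s 0 = 0.
Proof. by rewrite /radix_val big_ord0. Qed.
Lemma radix_valS k s l : radix_val k s l.+1 = radix_val k s l + s l * radix k l.
Proof. by rewrite /radix_val big_ord_recr. Qed.

Lemma radix_gt0 k l : (forall i, 0 < k i) -> 0 < radix k l.
Proof. by move=> k0; rewrite prodn_gt0. Qed.

Lemma ltn_radix k l : (forall i, 2 <= k i) -> l < radix k l.
Proof.
move=> k2; elim: l => [|l IH]; first by rewrite radix0.
rewrite radixS (leq_ltn_trans IH) // -[ltnLHS]muln1 ltn_pmul2l ?k2 //.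
exact: leq_trans IH.
Qed.

Lemma radix_val_lt k s l : (forall i, s i < k i) -> radix_val k s l < radix k l.
Proof.
move=> sk; elim: l => [|l IH]; first by rewrite radix_val0 radix0.
rewrite radix_valS radixS (@leq_trans (radix k l + s l * radix k l)) ?ltn_add2r //.
by rewrite -mulSn mulnC leq_mul.
Qed.

Lemma radix_val_digits k i l : (forall j, 0 < k j) ->
  radix_val k (fun j => (i %/ radix k j) %% k j) l = i %% radix k l.
Proof.
move=> k0; elim: l => [|l IH]; first by rewrite radix_val0 radix0 modn1.
rewrite radix_valS IH radixS.
set r := radix k l; have r0 : 0 < r by exact: radix_gt0.
have -> : i %% (r * k l) = (i %/ r %% k l * r + i %% r) %% (r * k l).
  rewrite {1}(divn_eq i r) {1}(divn_eq (i %/ r) (k l)) mulnDl -mulnA.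
  by rewrite [k l * r]mulnC -addnA modnMDl.
rewrite [RHS]modn_small; first exact: addnC.
apply: (@leq_trans ((i %/ r) %% k l * r + r)); first by rewrite ltn_add2l ltn_mod.
by rewrite addnC -mulSn mulnC leq_mul2l ltn_mod k0 orbT.
Qed.

(** Coding the first [l] digits by one number below [radix k l] is what makes the
    compatibility of levels a congruence. *)
Lemma digits_coords (T : topologicalType) (k : nat -> nat) (d : nat -> T -> nat) :
  (forall i, 0 < k i) -> (forall i x, d i x < k i) ->
  (forall i x, nbhs x [set y | d i y = d i x]) ->
  (forall x y, (forall i, d i x = d i y) -> x = y) ->
  (forall s, (forall i, s i < k i) -> exists x, forall i, d i x = s i) ->
  coords (radix k) (fun l x => radix_val k (d ^~ x) l).
Proof.
move=> k0 dk dc dsep donto.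
have vc l x : nbhs x [set y | radix_val k (d ^~ y) l = radix_val k (d ^~ x) l].
  elim: l => [|l IH]; first by apply: filterE => y /=; rewrite !radix_val0.
  by apply: filterS2 (dc l x) IH => y /= e e'; rewrite !radix_valS e e'.
split.
- by move=> l x; apply: radix_val_lt.
- by move=> l i; rewrite openE => x /= <-; exact: vc.
- move=> l x; rewrite radix_valS addnC modnMDl modn_small //.
  exact: radix_val_lt.
- move=> x y e; apply: dsep => i; have := e i.+1.
  rewrite !radix_valS e => /addnI/eqP; rewrite eqn_pmul2r; first by move/eqP.
  exact: radix_gt0.
- move=> l i il; have [|x xP] := donto (fun j => (i %/ radix k j) %% k j).
    by move=> j; rewrite ltn_mod.
  exists x; rewrite -[RHS](modn_small il) -radix_val_digits //.
  by apply: eq_bigr => j _; rewrite xP.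
- by move=> l; rewrite radixS dvdn_mulr.
Qed.

Section OdometerSpace.
Context (k : nat -> nat).
Hypothesis k2 : forall i, 2 <= k i.

Definition odometer_coord l (y : odometer_space k) : nat :=
  radix_val k (fun i => y i) l.

Lemma odometer_space_compact : compact [set: odometer_space k].
Proof.
have fin i : compact [set: discrete_topology 'I_(k i)].
  by apply: finite_compact; exact: (@finite_finset 'I_(k i) setT).
have := tychonoff fin.
by congr (compact _); apply/seteqP; split.
Qed.

Lemma odometer_coords : coords (radix k) odometer_coord.
Proof.
apply: digits_coords => [i|i x|i x|x y e|s sk].
- exact: ltnW.
- exact: ltn_ord.
- have pc : {for x, continuous (fun y : odometer_space k => y i)} by exact: proj_continuous.
  apply: (pc [set a : discrete_topology 'I_(k i) | a = x i :> nat]).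
  by apply: open_nbhs_nbhs; split => //; exact: discrete_open.
- by apply: functional_extensionality_dep => i; apply: val_inj; exact: e.
- by exists (fun i => Ordinal (sk i)).
Qed.

Lemma add_one_digit (y : odometer_space k) j :
  add_one y j = (if [forall i : 'I_j, y i == (k i).-1 :> nat]
    then (if y j == (k j).-1 :> nat then 0 else (y j).+1) else y j) :> nat.
Proof.
have ndig i : (y i < (k i).-1) = (y i != (k i).-1 :> nat).
  by rewrite ltn_neqAle -ltnS (ltn_predK (k2 i)) ltn_ord andbT.
rewrite /add_one; case: pselect => [ex_i|nex]; last first.
  have ymax i : y i == (k i).-1 :> nat.
    by apply/negPn/negP; rewrite -ndig => ?; apply: nex; exists i.
  by rewrite ymax; case: ifP => // /forallP[].
case: ex_minnP => m ym mmin; case: ltngtP => [jm|mj|->] /=.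
- have ymax i : i < m -> y i == (k i).-1 :> nat.
    by move=> im; apply/negPn; rewrite -ndig; apply: contraL im => /mmin; rewrite leqNgt.
  rewrite ymax //; case: ifP => // /forallP[] i; apply: ymax.
  exact: ltn_trans jm.
- case: ifP => // /forallP/(_ (Ordinal mj)) /= e.
  by move: ym; rewrite ndig e.
have -> : [forall i : 'I_m, y i == (k i).-1 :> nat].
  apply/forallP => i; apply/negPn; rewrite -ndig; apply: contraL (ltn_ord i) => /mmin.
  by rewrite leqNgt.
rewrite ndig in ym; rewrite (negPf ym) modn_small //.
by rewrite -ndig in ym; rewrite -[X in _ < X](ltn_predK (k2 m)) ltnS.
Qed.

Lemma add_one_coord l (y : odometer_space k) :
  odometer_coord l (add_one y) = (odometer_coord l y).+1 %% radix k l.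
Proof.
(* The induction on the carry needs to know that a block of maximal digits
   wraps around to zero. *)
suff : if [forall i : 'I_l, y i == (k i).-1 :> nat]
  then odometer_coord l (add_one y) = 0 /\ (odometer_coord l y).+1 = radix k l
  else odometer_coord l (add_one y) = (odometer_coord l y).+1.
  case: ifP => [_ [-> ->]|_ e]; first by rewrite modnn.
  rewrite e modn_small // -e; exact: (co_lt odometer_coords).
rewrite /odometer_coord; elim: l => [|l IH].
  by rewrite ifT ?radix_val0 ?radix0 //; apply/forallP => -[].
have forS : [forall i : 'I_l.+1, y i == (k i).-1 :> nat] =
    [forall i : 'I_l, y i == (k i).-1 :> nat] && (y l == (k l).-1 :> nat).
  apply/forallP/andP => [yP|[/forallP yP yl] i].
    by split; [apply/forallP => i; exact: (yP (widen_ord (leqnSn l) i))|exact: (yP ord_max)].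
  have := ltn_ord i; rewrite ltnS leq_eqVlt => /predU1P[e|il].
    by rewrite e.
  exact: (yP (Ordinal il)).
rewrite forS !radix_valS add_one_digit; case: ifP IH => [_ [-> e]|_ ->] //=.
case: eqP => [yl|_]; last by rewrite -addSn e add0n mulSn.
by rewrite -addSn e mul0n yl -mulSn (ltn_predK (k2 l)) radixS mulnC.
Qed.
End OdometerSpace.

Lemma cantor_coords (X : topologicalType) : is_cantor_space X ->
  compact [set: X] /\ exists c : nat -> X -> nat, coords (radix (fun=> 2)) c.
Proof.
move=> [h]; split; first exact: homeo_compact h cantor_space_compact.
have cc : coords (radix (fun=> 2))
    (fun l (x : cantor_space) => radix_val (fun=> 2) (fun i => x i) l).
  apply: digits_coords => [//|i x|i x|x y e|s s2].
  - by case: (x i).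
  - have pc : {for x, continuous (fun y : cantor_space => y i)} by exact: proj_continuous.
    apply: (pc [set a : bool | a = x i :> nat]).
    by apply: open_nbhs_nbhs; split => //; exact: discrete_open.
  - by apply: functional_extensionality_dep => i; have := e i; case: (x i) (y i) => [] [].
  - exists (fun i => s i == 1) => i.
    by case: (s i) (s2 i) => [|[|]].
by exists (fun l => (fun x => radix_val (fun=> 2) (fun i => homeo_inv h x i) l));
  exact: coords_homeo cc.
Qed.

(** * Odometers as translations of the coordinates *)

(** In the inverse limit described by the coordinates, [f] is the translation
    by 1. *)
Definition steps (T : Type) (N : nat -> nat) (c : nat -> T -> nat) (f : T -> T) :=
  forall l x, c l (f x) = (c l x).+1 %% N l.

Lemma eq_mod_succ N i j : i < N -> j < N -> i.+1 %% N = j.+1 %% N -> i = j.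
Proof.
move=> iN jN /eqP; rewrite -[i.+1]addn1 -[j.+1]addn1 eqn_modDr !modn_small //; exact/eqP.
Qed.

Section Steps.
Context (T : topologicalType) (N : nat -> nat) (c : nat -> T -> nat).
Hypotheses (cpt : compact [set: T]) (co : coords N c).

Lemma steps_iter f : steps N c f ->
  forall l n x, c l (iter n f x) = (c l x + n) %% N l.
Proof.
move=> sf l; elim=> [|n IH] x; first by rewrite addn0 modn_small ?(co_lt co).
by rewrite iterS sf IH -addn1 modnDml addn1 addnS.
Qed.

Lemma steps_unique f g : steps N c f -> steps N c g -> f =1 g.
Proof. by move=> sf sg x; apply: (co_sep co) => l; rewrite sf sg. Qed.

(** The shifted coordinates [d] below are coordinates for the same moduli, and
    [f] is the homeomorphism that matches the two systems. *)
Lemma steps_homeo f : steps N c f -> exists g : homeo T T, f = g.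
Proof.
move=> sf; pose d l x := (c l x).+1 %% N l.
have N0 l (x : T) : 0 < N l by exact: leq_ltn_trans (co_lt co l x).
have cd : coords N d.
  split.
  - by move=> l x; rewrite ltn_mod N0.
  - move=> l i; rewrite openE => x /= <-.
    by apply: filterS (co_nbhs_cell co l x) => y /= e; rewrite /d e.
  - move=> l x; rewrite /d modn_dvdm ?(co_dvd co) // (co_mod co l x).
    by rewrite -[in LHS]addn1 modnDml addn1.
  - move=> x y e; apply: (co_sep co) => l.
    by apply: eq_mod_succ (e l); exact: (co_lt co).
  - move=> l i il; have Nl : 0 < N l by exact: leq_ltn_trans il.
    have [|x xP] := @co_onto _ _ _ co l ((i + (N l).-1) %% N l); first by rewrite ltn_mod.
    by exists x; rewrite /d xP -addn1 modnDml -addnA addn1 prednK // modnDr modn_small.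
  - exact: (co_dvd co).
have [g gP] := co_homeo cpt cpt cd co.
by exists g; apply/funext; apply: steps_unique => // l x; rewrite gP.
Qed.
End Steps.

Lemma odometer_steps (X : topologicalType) (g : X -> X) : is_odometer g ->
  exists2 k, (forall i, 2 <= k i) &
  exists2 c, coords (radix k) c & steps (radix k) c g.
Proof.
move=> [k k2 [h gE]]; exists k => //.
exists (fun l => @odometer_coord k l \o homeo_inv h).
  exact: coords_homeo (odometer_coords k2).
by move=> l x; rewrite gE /= homeoK add_one_coord.
Qed.

Lemma steps_odometer (X : topologicalType) (g : X -> X) k c :
  compact [set: X] -> (forall i, 2 <= k i) -> coords (radix k) c ->
  steps (radix k) c g -> is_odometer g.
Proof.
move=> cX k2 co sg; exists k => //.
have [h hP] := co_homeo (@odometer_space_compact k) cX (odometer_coords k2) co.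
exists h; apply/funext => x; apply: (co_sep co) => l /=.
by rewrite sg hP add_one_coord // -hP homeoVK.
Qed.

Lemma steps_conj (S T : topologicalType) N c d (f : S -> S) (g : T -> T) :
  compact [set: S] -> compact [set: T] -> coords N c -> coords N d ->
  steps N c f -> steps N d g ->
  exists2 h : homeo S T, (forall l x, d l (h x) = c l x) & h \o f =1 g \o h.
Proof.
move=> cS cT cc cd sf sg; have [h hP] := co_homeo cS cT cc cd.
exists h => // x; apply: (co_sep cd) => l /=.
by rewrite sg !hP sf.
Qed.

(** * Borel probability measures in coordinates *)

Section Msr.
Context (R : realType) (X : ptopologicalType).
Implicit Types (mu nu : probability (borel X) R) (A B : set X).

(** Real values are easier to add and compare than extended ones. *)
Definition msr mu A : R := fine (mu A).

Definition borelset A := measurable (A : set (borel X)).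

Lemma open_borelset A : open A -> borelset A.
Proof. exact: sub_sigma_algebra. Qed.

Lemma clopen_borelset A : clopen A -> borelset A.
Proof. by case=> /open_borelset. Qed.

Lemma msrE mu A : borelset A -> mu A = (msr mu A)%:E.
Proof. by move=> mA; rewrite /msr fineK // fin_num_measure. Qed.

Lemma msrT mu : msr mu setT = 1%R.
Proof. by rewrite /msr probability_setT. Qed.

Lemma msr0 mu : msr mu set0 = 0%R.
Proof. by rewrite /msr measure0. Qed.

Lemma msr_le mu A B : borelset A -> borelset B -> A `<=` B -> (msr mu A <= msr mu B)%R.
Proof.
move=> mA mB AB; rewrite -lee_fin -!msrE //.
by apply: le_measure; rewrite ?inE.
Qed.

Lemma msrU mu A B : borelset A -> borelset B -> A `&` B = set0 ->
  msr mu (A `|` B) = (msr mu A + msr mu B)%R.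
Proof.
move=> mA mB AB; apply: EFin_inj; rewrite EFinD -!msrE ?measureU //.
exact: measurableU.
Qed.

Lemma msrID mu A B : borelset A -> borelset B ->
  msr mu A = (msr mu (A `\` B) + msr mu (A `&` B))%R.
Proof.
move=> mA mB; rewrite -msrU.
- by congr (msr mu _); rewrite setUC setUIDK.
- exact: measurableD.
- exact: measurableI.
- by rewrite setDE setIACA setICl setI0.
Qed.

Lemma msr_bigU mu n (F : nat -> set X) A :
  (forall i, i < n -> borelset (F i)) ->
  (forall i j x, i < n -> j < n -> F i x -> F j x -> i = j) ->
  (forall x, A x <-> exists2 i, i < n & F i x) ->
  msr mu A = (\sum_(i < n) msr mu (F i))%R.
Proof.
elim: n A => [|n IH] A mF dF AE.
  by rewrite big_ord0; have -> : A = set0; rewrite ?msr0 // -subset0 => x /AE[].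
rewrite big_ord_recr /=; pose A' := [set x | exists2 i, i < n & F i x].
have mA' : borelset A'.
  have -> : A' = \big[setU/set0]_(i < n) F i.
    by rewrite -bigcup_mkord.
  by apply: bigsetU_measurable => i _; apply: mF; rewrite ltnS ltnW.
rewrite -(IH A') //; first last.
- by move=> i j x /ltnW il /ltnW jl; exact: dF.
- by move=> i il; apply: mF; rewrite ltnS ltnW.
rewrite -msrU //; first last.
- rewrite -subset0 => x [[i il Fi] Fn].
  by have := dF _ _ x (ltnW il) (ltnSn n) Fi Fn; move: il => /[swap] ->; rewrite ltnn.
- exact: mF.
congr (msr mu _); apply/seteqP; split=> x.
  move=> /AE[i]; rewrite ltnS leq_eqVlt => /predU1P[->|il] Fx; first by right.
  by left; exists i.
by case=> [[i il Fx]|Fx]; apply/AE; [exists i => //; exact: ltnW|exists n].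
Qed.

Lemma msr_cover mu n (F : nat -> set X) A : borelset A ->
  (forall i, i < n -> borelset (F i)) ->
  (forall x, A x -> exists2 i, i < n & F i x) ->
  (msr mu A <= \sum_(i < n) msr mu (F i))%R.
Proof.
elim: n A => [|n IH] A mA mF AF.
  rewrite big_ord0; have -> : A = set0; rewrite ?msr0 // -subset0 => x.
  by move=> /AF[].
rewrite big_ord_recr /= (msrID mu mA (mF _ (ltnSn n))) lerD //.
  apply: IH; first by apply: measurableD => //; exact: mF.
    by move=> i il; apply: mF; rewrite ltnS ltnW.
  move=> x [/AF[i]]; rewrite ltnS leq_eqVlt => /predU1P[->|il] // Fx _.
  by exists i.
apply: msr_le; [|exact: mF|by move=> x []].
by apply: measurableI => //; exact: mF.
Qed.

Lemma msr_packing mu n (F : nat -> set X) A : borelset A ->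
  (forall i, i < n -> borelset (F i)) ->
  (forall i j x, i < n -> j < n -> F i x -> F j x -> i = j) ->
  (forall i, i < n -> F i `<=` A) ->
  (\sum_(i < n) msr mu (F i) <= msr mu A)%R.
Proof.
move=> mA mF dF FA; pose B := [set x | exists2 i, i < n & F i x].
rewrite -(@msr_bigU mu n F B) //; apply: msr_le => //; last first.
  by move=> x [i /FA]; exact.
have -> : B = \big[setU/set0]_(i < n) F i.
  by rewrite -bigcup_mkord.
by apply: bigsetU_measurable => i _; exact: mF.
Qed.



Context (N : nat -> nat) (c : nat -> X -> nat).
Hypotheses (cpt : compact [set: X]) (co : coords N c).

Lemma co_borelset A l : (forall x y, c l x = c l y -> A x -> A y) -> borelset A.
Proof. by move=> Al; apply: clopen_borelset; apply/(co_clopen cpt co); exists l. Qed.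

(** There are only countably many cells, and they form a base. *)
Lemma borel_clopen :
  @measurable _ (borel X) = <<s [set A : set X | clopen A] >>.
Proof.
apply/seteqP; split; apply: smallest_sub; try exact: smallest_sigma_algebra.
  move=> U oU; pose G n := if unpickle n is Some p
    then [set x | c p.1 x = p.2 /\ [set y | c p.1 y = p.2] `<=` U] else set0.
  have -> : U = \bigcup_n G n.
    apply/seteqP; split=> [x Ux|x [n _]]; last first.
      by rewrite /G; case: unpickle => // -[l i] /= [] ? ; apply.
    have /(co_nbhs cpt co)[l lU] : nbhs x U by apply: open_nbhs_nbhs.
    by exists (pickle (l, c l x)) => //; rewrite /G pickleK.
  apply: sigma_algebra_bigcup => n; apply: sub_gen_smallest.
  rewrite /G; case: unpickle => [[l i]|]; last exact: clopen0.
  by apply/(co_clopen cpt co); exists l => x y /= ->.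
move=> A /= cA; exact: clopen_borelset.
Qed.

Lemma measure_eq_clopen (m1 m2 : {measure set (borel X) -> \bar R}%R) :
  (m1 setT < +oo)%E -> (forall A, clopen A -> m1 A = m2 A) -> measure_eq m1 m2.
Proof.
move=> m1T m12 A mA.
apply: (@measure_unique _ R (borel X) [set A : set X | clopen A] (fun=> setT) _ _ _ _ m1 m2) => //.
- exact: borel_clopen.
- by move=> B C; exact: clopenI.
- by move=> _; exact: clopenT.
- by rewrite bigcup_const.
Qed.

Lemma measure_eq_cells mu nu :
  (forall l i, i < N l -> msr mu [set x | c l x = i] = msr nu [set x | c l x = i]) ->
  measure_eq mu nu.
Proof.
move=> e; apply: measure_eq_clopen => [|A /[dup] cA /(co_clopen cpt co)[l lA]].
  by apply: (le_lt_trans (probability_le1 mu measurableT)); exact: ltry.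
have bA := clopen_borelset cA.
suff emn : msr mu A = msr nu A.
  exact: (etrans (msrE mu bA) (etrans (congr1 EFin emn) (esym (msrE nu bA)))).
pose F i := A `&` [set x | c l x = i].
have mF i : borelset (F i).
  by apply: (@co_borelset _ l) => x y e1 [Ax /= <-]; split=> //; exact: lA Ax.
have dF i j x : i < N l -> j < N l -> F i x -> F j x -> i = j.
  by move=> _ _ [_ <-] [_ <-].
have AF x : A x <-> exists2 i, i < N l & F i x.
  by split=> [Ax|[i _ []]//]; exists (c l x); [exact: (co_lt co)|].
rewrite !(@msr_bigU _ (N l) F) //; apply: eq_bigr => i _.
have [[x [Ax xi]]|nF] := pselect (exists x, F i x).
  have -> : F i = [set x | c l x = i]; last exact: e.
  apply/seteqP; split=> [y []//|y yi]; split=> //.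
  by apply: lA Ax; rewrite xi.
have -> : F i = set0; last by rewrite !msr0.
by rewrite -subset0 => x Fx; apply: nF; exists x.
Qed.

Lemma invariant_measure_clopen (f : homeo X X) mu :
  (forall A, clopen A -> msr mu (f @^-1` A) = msr mu A) -> invariant_measure f mu.
Proof.
move=> fA.
have mf : measurable_fun [set: borel X] (f : borel X -> borel X).
  by move=> _ A mA; rewrite setTI; exact: homeo_measurable.
pose m := measure_function_pushforward__canonical__measure_function_Measure mu mf.
apply: (@measure_eq_clopen m mu).
  by rewrite /= /pushforward preimage_setT; apply: (le_lt_trans (probability_le1 mu measurableT)); exact: ltry.
move=> A cA; have bA := clopen_borelset cA; have bfA := clopen_borelset (homeo_clopen f cA).
exact: (etrans (msrE mu bfA) (etrans (congr1 EFin (fA A cA)) (esym (msrE mu bA)))).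
Qed.

Lemma msr_invariant (f : homeo X X) mu A : invariant_measure f mu -> borelset A ->
  msr mu (f @^-1` A) = msr mu A.
Proof. by move=> fi mA; rewrite /msr -[in RHS](fi A mA). Qed.
End Msr.

(** * The groups G_K in coordinates *)

Section GKcoords.
Context (R : realType) (X : ptopologicalType) (K : set (probability (borel X) R)).
Context (N : nat -> nat) (c : nat -> X -> nat).
Hypotheses (cpt : compact [set: X]) (co : coords N c).
Implicit Types f g h : GK K.

Lemma GK_msr f mu A : K mu -> borelset A -> msr mu (f @^-1` A) = msr mu A.
Proof. by move=> Kmu mA; apply: msr_invariant => //; exact: GK_invariant. Qed.

Lemma GK_msrV f mu A : K mu -> borelset A -> msr mu (homeo_inv f @^-1` A) = msr mu A.
Proof. exact: (GK_msr (f^-1)%g). Qed.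

Lemma GK_borelset f A : borelset A -> borelset (f @^-1` A).
Proof. exact: homeo_measurable. Qed.

Lemma GK_borelsetV f A : borelset A -> borelset (homeo_inv f @^-1` A).
Proof. exact: (GK_borelset (f^-1)%g). Qed.

Lemma homeo_image (f : homeo X X) A : f @` A = homeo_inv f @^-1` A.
Proof.
apply/seteqP; split=> [_ [x Ax <-]|x Ax]; first by rewrite /= homeoK.
by exists (homeo_inv f x) => //; rewrite homeoVK.
Qed.

Lemma GK_iter f n : exists g, (g : X -> X) = iter n f.
Proof.
elim: n => [|n [g gE]]; first by exists 1%g.
by exists (f * g)%g; apply/funext => x /=; rewrite gE.
Qed.

(** Gluing: [s] preserves the measures because the pieces [lab x = j] and their
    images under [rho j] both partition the space. *)
Lemma GK_piecewise (s s' : X -> X) (rho : nat -> GK K) (lab : X -> nat) k l :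
  cancel s s' -> cancel s' s -> (forall x, lab x < k) ->
  (forall x y, c l x = c l y -> lab x = lab y) ->
  (forall x, s x = rho (lab x) x) ->
  exists g, (g : X -> X) = s /\ homeo_inv g = s'.
Proof.
move=> sK s'K labk labl sE.
have sc : continuous s.
  apply: (co_continuous cpt co) => m x.
  have /(_ _ (co_nbhs_cell co m _)) := homeo_cont (rho (lab x)) x.
  move: (co_nbhs_cell co l x); apply: filterS2 => y e /=.
  by rewrite !sE (labl _ _ e).
have labV j y : lab (homeo_inv (rho j) y) = j -> s' y = homeo_inv (rho j) y.
  by move=> e; apply: (can_inj sK); rewrite s'K sE e homeoVK.
have s'E y : s' y = homeo_inv (rho (lab (s' y))) y.
  by apply: (can_inj (homeoK (rho (lab (s' y))))); rewrite homeoVK -sE s'K.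
have s'c : continuous s'.
  apply: (co_continuous cpt co) => m y.
  have pre n : nbhs y [set z | c n (homeo_inv (rho (lab (s' y))) z) = c n (s' y)].
    have := (homeoV_cont (rho (lab (s' y))) y _ (co_nbhs_cell co n _)).
    by rewrite -s'E.
  apply: filterS2 (pre l) (pre m) => z /= el em.
  by rewrite (labV _ _ (labl _ _ el)) em.
pose h := Homeo sK s'K sc s'c.
suff hK mu : K mu -> invariant_measure h mu by exists (MkGK hK).
move=> Kmu; apply: (invariant_measure_clopen cpt co) => A cA.
have bA := clopen_borelset cA.
pose L j := [set x | lab x = j].
have bL j : borelset (L j).
  by apply: (co_borelset cpt co (l := l)) => x y e /= <-; apply/esym; exact: labl.
pose G j := A `&` homeo_inv (rho j) @^-1` L j.
have bG j : borelset (G j) by apply: measurableI => //; exact: GK_borelsetV.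
have GE j y : G j y <-> A y /\ lab (s' y) = j.
  split=> [[Ay /= e]|[Ay e]]; first by rewrite (labV j).
  by split=> //=; rewrite /L /= -{1}e -s'E.
rewrite (@msr_bigU _ _ mu k G A) //; first last.
- move=> y; split=> [Ay|[j _ /GE[]]] //.
  by exists (lab (s' y)) => //; apply/GE.
- by move=> i j x _ _ /GE[_ <-] /GE[].
rewrite (@msr_bigU _ _ mu k (fun j => rho j @^-1` G j)) //; first last.
- move=> x; split=> [Ax|[j _ [Aj]]].
    by exists (lab x) => //; apply/GE; rewrite -sE sK.
  by rewrite /= /L /= homeoK => e; rewrite sE e.
- by move=> i j x _ _ [_ +] [_ +]; rewrite /L /= !homeoK => <-.
- by move=> i _; exact: GK_borelset.
by apply: eq_bigr => j _; apply: GK_msr.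
Qed.

(** Having the same images of the clopen sets of level [n] becomes a pointwise
    equation once it is stated with inverses.  These relations define the topology
    of [GK K], see [nbhs_GK_coincide]. *)
Definition coincide n f g := forall x, c n (homeo_inv g x) = c n (homeo_inv f x).

Lemma coincide_refl n f : coincide n f f. Proof. by []. Qed.

Lemma coincide_trans n f g h : coincide n f g -> coincide n g h -> coincide n f h.
Proof. by move=> fg gh x; rewrite gh fg. Qed.

Lemma coincide_le m n f g : m <= n -> coincide n f g -> coincide m f g.
Proof. by move=> mn fg x; exact: (co_coarse co mn). Qed.

Lemma coincide_image n f g A : (forall x y, c n x = c n y -> A x -> A y) ->
  coincide n f g -> g @` A = f @` A.
Proof.
move=> nA fg; rewrite !homeo_image.
by apply/seteqP; split=> x /=; apply: nA; rewrite fg.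
Qed.

Lemma nbhs_GK_coincide f (U : set (GK K)) :
  nbhs f U <-> exists n, forall g, coincide n f g -> U g.
Proof.
split=> [/nbhs_GKP[P [fP [cP _ _] oP] PU]|[n nU]].
  have /choice[l lP] : forall A, exists l, P A -> forall x y, c l x = c l y -> A x -> A y.
    move=> A; have [/oP/(co_clopen cpt co)[l lA]|nPA] := pselect (P A).
      by exists l.
    by exists 0.
  have /finite_seqP[s sE] := fP.
  exists (\max_(A <- s) l A) => g fg; apply: PU.
  exists (f^-1 * g)%g; last by rewrite mulgA mulgV mul1g.
  move=> A PA; have As : A \in s by move: PA; rewrite sE.
  have lA : coincide (l A) f g by apply: coincide_le fg; exact: leq_bigmax_seq.
  have -> : (f^-1 * g)%g @` A = homeo_inv f @` (g @` A).
    by rewrite image_comp.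
  rewrite (coincide_image (lP A PA) lA) image_comp.
  by apply/seteqP; split=> [_ [x Ax <-]|x Ax]; [rewrite /= homeoK|exists x => //=; rewrite homeoK].
apply/nbhs_GKP.
exists [set A | exists2 i, i < N n & A = [set x | c n x = i]].
  split.
  - apply: (@sub_finite_set _ _ ((fun i => [set x | c n x = i]) @` `I_(N n))).
      by move=> A [i iN ->]; exists i.
    exact/finite_image/finite_II.
  - split.
    + rewrite -subTset => x _; exists [set y | c n y = c n x] => //.
      by exists (c n x) => //; exact: (co_lt co).
    + by move=> _ _ [i _ ->] [j _ ->] [x [/= <- <-]].
    + by move=> _ [i iN ->]; have [x] := co_onto co iN; exists x.
  - by move=> _ [i _ ->]; exact: (co_clopen_cell cpt co).
move=> _ [u uP <-]; apply: nU => x.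
have /uP : exists2 i, i < N n & [set y | c n y = c n (homeo_inv f x)] = [set y | c n y = i].
  by exists (c n (homeo_inv f x)) => //; exact: (co_lt co).
by rewrite homeo_image => /seteqP[_ /(_ (homeo_inv f x) erefl)].
Qed.

Lemma nbhs_GKstar_coincide (f : GKstar K) (U : set (GKstar K)) :
  nbhs f U <-> exists n, forall g : GKstar K, coincide n (val f) (val g) -> U g.
Proof.
split.
  rewrite nbhsE => -[V [[W oW <-] /= Wf] VU].
  have /nbhs_GK_coincide[n nW] : nbhs (set_val f) W by apply: open_nbhs_nbhs.
  by exists n => g /nW Wg; exact: VU.
move=> [n nU]; have := @initial_continuous _ (GK K) (@set_val _ (GKstar K)) f.
move=> /(_ [set g | coincide n (val f) g]) sc.
by apply: filterS nU _; apply: sc; apply/nbhs_GK_coincide; exists n.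
Qed.

(** Since inversion is continuous, the map itself is controlled as well, but at
    another level. *)
Lemma coincide_forward n f : exists m, forall g, coincide m f g -> forall x, c n (g x) = c n (f x).
Proof.
have [m mP] := co_continuous_uniform cpt co (homeo_cont f) n.
exists m => g fg y; have := mP _ _ (fg (g y)).
by rewrite homeoK homeoVK => ->.
Qed.

Lemma coincide_iterV n p f : exists m, forall g, coincide m f g -> forall i x, i <= p ->
  c n (iter i (homeo_inv g) x) = c n (iter i (homeo_inv f) x).
Proof.
elim: p n => [|p IH] n.
  by exists 0 => g _ i x; rewrite leqn0 => /eqP ->.
have [m1 m1P] := co_continuous_uniform cpt co (homeoV_cont f) n.
have [m2 m2P] := IH m1.
exists (maxn n m2) => g fg [|i] x ip //=.
rewrite (coincide_le (leq_maxl n m2) fg); apply: m1P; apply: m2P => //.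
exact: coincide_le (leq_maxr n m2) fg.
Qed.

End GKcoords.

(** * Invariant measures of odometers *)

(** Sequences of moduli that are cofinal for divisibility have the same inverse
    limit. *)
Lemma co_regrade (T : topologicalType) (x0 : T) N c N' : coords N c ->
  (forall l, N' l %| N' l.+1) -> (forall l, exists m, N' l %| N m) ->
  (forall m, exists l, N m %| N' l) ->
  exists2 c' : nat -> T -> nat, coords N' c' &
    forall f, steps N c f -> steps N' c' f.
Proof.
move=> co N'dvd /choice[m mP] NN'.
have N0 l : 0 < N l by exact: leq_ltn_trans (co_lt co l x0).
have modE l a b x : N' l %| N a -> N' l %| N b -> c a x %% N' l = c b x %% N' l.
  wlog ab : a b / a <= b.
    move=> W; case: (leqP a b) => [|/ltnW] ab da db; first exact: W.
    by apply/esym; exact: W.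
  by move=> da db; rewrite (co_mod_le co _ ab) modn_dvdm.
exists (fun l x => c (m l) x %% N' l); last first.
  by move=> f sf l x; rewrite sf modn_dvdm // -addn1 -modnDml addn1.
split => //.
- by move=> l x; rewrite ltn_mod; exact: dvdn_gt0 (mP l).
- move=> l i; rewrite openE => x /= <-.
  by apply: filterS (co_nbhs_cell co (m l) x) => y /= ->.
- move=> l x; rewrite modn_dvdm //; apply: modE => //.
  exact: dvdn_trans (N'dvd l) (mP _).
- move=> x y e; apply: (co_sep co) => a; have [l al] := NN' a.
  have aml : N a %| N (m l) by exact: dvdn_trans (mP l).
  have cE z : c a z = (c (m l) z %% N' l) %% N a.
    rewrite modn_dvdm //; case: (leqP a (m l)) => [am|/ltnW ma].
      exact: (co_mod_le co).
    have e1 : N a = N (m l).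
      by apply/eqP; rewrite eqn_dvd aml (co_dvd_le co).
    by rewrite e1 modn_small ?(co_lt co) // (co_mod_le co z ma) modn_small // -e1 (co_lt co).
  by rewrite !cE e.
- move=> l i il; have [|x xP] := @co_onto _ _ _ co (m l) i.
    by apply: leq_trans il _; apply: dvdn_leq.
  by exists x; rewrite xP modn_small.
Qed.

Section InvariantMsr.
Context (R : realType) (X : ptopologicalType) (N : nat -> nat) (c : nat -> X -> nat).
Hypotheses (cpt : compact [set: X]) (co : coords N c).
Context (f : X -> X) (mu : probability (borel X) R).
Hypotheses (sf : steps N c f)
  (fmu : forall A, borelset A -> msr mu (f @^-1` A) = msr mu A).

(** [f] permutes the cells of a level cyclically. *)
Lemma msr_cell l i : i < N l -> msr mu [set x | c l x = i] = ((N l)%:R^-1)%R.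
Proof.
have bc j : borelset [set x | c l x = j].
  by apply: clopen_borelset; exact: (co_clopen_cell cpt co).
have cell0 j : j < N l -> msr mu [set x | c l x = j] = msr mu [set x | c l x = 0].
  elim: j => // j IH jN; rewrite -IH 1?ltnW // -fmu //; congr (msr mu _).
  apply/seteqP; split=> x /=; rewrite sf => e; last by rewrite e modn_small.
  apply: (@eq_mod_succ (N l)); [exact: (co_lt co)|exact: ltnW|].
  by rewrite e modn_small.
move=> il; rewrite cell0 //.
have N0 : ((N l)%:R != 0 :> R)%R by rewrite pnatr_eq0; case: (N l) il.
apply: (mulIf N0); rewrite mulVf // -[RHS](msrT mu).
rewrite (@msr_bigU _ _ mu (N l) (fun j => [set x | c l x = j]) setT) //.
- rewrite (eq_bigr (fun=> msr mu [set x | c l x = 0])) => [|j _]; last exact: cell0.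
  by rewrite sumr_const card_ord mulr_natr.
- by move=> j k x _ _ <- <-.
- by move=> x; split=> // _; exists (c l x) => //; exact: (co_lt co).
Qed.

Lemma msr_count l A : (forall x y, c l x = c l y -> A x -> A y) ->
  msr mu A =
  ((\sum_(i < N l) `[< exists x, c l x = i /\ A x >])%:R / (N l)%:R)%R.
Proof.
move=> lA; pose F i := A `&` [set x | c l x = i].
rewrite (@msr_bigU _ _ mu (N l) F A) //; first last.
- move=> x; split=> [Ax|[i _ []]//]; exists (c l x) => //; exact: (co_lt co).
- by move=> i j x _ _ [_ <-] [_ <-].
- move=> i _; apply: (co_borelset cpt co (l := l)) => x y e [Ax /= <-].
  by split=> //; exact: lA Ax.
rewrite natr_sum mulr_suml; apply: eq_bigr => i _.
case: asboolP => [[x [xi Ax]]|nx].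
  rewrite mul1r -(@msr_cell l i) //; congr (msr mu _).
  by apply/seteqP; split=> [y []//|y /= yi]; split=> //; apply: lA Ax; rewrite xi.
rewrite mul0r; have -> : F i = set0; last exact: msr0.
by rewrite -subset0 => x [Ax xi]; apply: nx; exists x.
Qed.
End InvariantMsr.

(** A cell of [c] is a union of cells of some level [m] of [d], so [1 / N l] is an
    integral multiple of [1 / M m]. *)
Lemma steps_dvd (R : realType) (X : ptopologicalType) N c M d (f g : X -> X)
    (mu : probability (borel X) R) :
  compact [set: X] -> coords N c -> coords M d -> steps N c f -> steps M d g ->
  (forall A, borelset A -> msr mu (f @^-1` A) = msr mu A) ->
  (forall A, borelset A -> msr mu (g @^-1` A) = msr mu A) ->
  forall l, exists m, N l %| M m.
Proof.
move=> cpt cc cd sf sg fmu gmu l.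
have N0 : 0 < N l by exact: leq_ltn_trans (co_lt cc l point).
have /(co_clopen cpt cd)[m mA] := co_clopen_cell cpt cc l 0.
have M0 : 0 < M m by exact: leq_ltn_trans (co_lt cd m point).
exists m; have := msr_count cpt cd sg gmu mA.
rewrite (msr_cell cpt cc sf fmu N0); set a := (\sum_(i < _) _).
have Nr : ((N l)%:R != 0 :> R)%R by rewrite pnatr_eq0 -lt0n.
have Mr : ((M m)%:R != 0 :> R)%R by rewrite pnatr_eq0 -lt0n.
move=> e; have : ((N l * a)%:R = (M m)%:R :> R)%R.
  rewrite natrM; have -> : (a%:R = (M m)%:R / (N l)%:R :> R)%R by rewrite e mulrC mulfVK.
  by rewrite mulrC mulfVK.
by move=> /eqP; rewrite eqr_nat => /eqP <-; exact: dvdn_mulr.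
Qed.

(** * Maps all of whose clopen sets are periodic *)

Section Periodic.
Context (R : realType) (X : ptopologicalType) (K : set (probability (borel X) R)).
Context (N : nat -> nat) (c : nat -> X -> nat).
Hypotheses (cpt : compact [set: X]) (co : coords N c).

Lemma iter_uniform (f : X -> X) : continuous f -> forall l p, exists m,
  forall x y, c m x = c m y -> forall i, i <= p -> c l (iter i f x) = c l (iter i f y).
Proof.
move=> fc l; elim=> [|p [m mP]].
  by exists l => x y e i; rewrite leqn0 => /eqP ->.
have [a aP] := co_continuous_uniform cpt co fc m.
exists (maxn a l) => x y e [|i] ip; first exact: (co_coarse co (leq_maxr _ _) e).
by rewrite !iterSr; apply: mP => //; apply: aP; exact: (co_coarse co (leq_maxl _ _) e).
Qed.

(** By assumption the itinerary of every point through the cells of level [l] is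
    periodic.  The points whose itinerary is a shift of that of a base point form
    an invariant clopen set, hence the whole space; the amount of the shift, modulo
    the least period [M l], is the new coordinate. *)
Lemma periodic_coords (f : GKstar K) :
  (forall l, exists2 p, 0 < p & forall x, c l (iter p (val f) x) = c l x) ->
  exists M d, coords M d /\ steps M d (val f).
Proof.
set F : X -> X := val f => per.
pose a l i := c l (iter i F point).
pose isper l p := forall i, a l (i + p) = a l i.
have isperP l : exists p, (0 < p) && `[< isper l p >].
  have [p p0 pP] := per l; exists p; rewrite p0; apply/asboolP => i.
  by rewrite /a addnC iterD pP.
pose M l := ex_minn (isperP l).
have M0 l : 0 < M l by rewrite /M; case: ex_minnP => m /andP[].
have Mper l : isper l (M l) by rewrite /M; case: ex_minnP => m /andP[_ /asboolP].
have Mperk l k i : a l (i + k * M l) = a l i.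
  by elim: k i => [|k IH] i; rewrite ?addn0 // mulSn addnA IH Mper.
have Mmod l i : a l (i %% M l) = a l i.
  by rewrite [in RHS](divn_eq i (M l)) addnC Mperk.
have Mdvd l p : isper l p -> M l %| p.
  move=> pP; have rP : isper l (p %% M l).
    by move=> i; rewrite -(Mperk l (p %/ M l)) -addnA [_ %% _ + _]addnC -divn_eq pP.
  rewrite /dvdn -leqn0 leqNgt; apply/negP => r0; have := ltn_pmod p (M0 l).
  rewrite ltnNge => /negP; apply; rewrite {1}/M; case: ex_minnP => m _; apply.
  by rewrite r0; exact/asboolP.
pose itin l i x := forall j, c l (iter j F x) = a l (i + j).
have itin_loc l : exists m, forall x y, c m x = c m y -> forall i, itin l i x -> itin l i y.
  have [p p0 pP] := per l; have [m mP] := iter_uniform (homeo_cont (val f)) l p.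
  exists m => x y e i ix j; rewrite -ix.
  have red z : c l (iter j F z) = c l (iter (j %% p) F z).
    rewrite {1}(divn_eq j p) addnC; elim: (j %/ p) => [|k IH]; first by rewrite addn0.
    by rewrite mulSn addnCA iterD pP.
  by rewrite !red; apply/esym/mP => //; exact/ltnW/ltn_pmod.
have itin_ex l x : exists i, itin l i x.
  pose U := [set x | exists i, itin l i x].
  suff UT : U = setT by rewrite -[_ _]/(U x) UT.
  have cU : clopen U.
    have [m mP] := itin_loc l; apply/(co_clopen cpt co); exists m.
    by move=> y z e [i /(mP _ _ e)]; exists i.
  have U0 : U !=set0 by exists point, 0.
  apply: contrapT => UT.
  have /set_mem/(_ U cU U0 UT) := valP f; apply.
  apply/seteqP; split=> [_ [y [i iy] <-]|y [i iy]].
    by exists i.+1 => j; rewrite -iterSr iy addSnnS.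
  exists (homeo_inv (val f) y); last exact: homeoVK.
  have [p p0 pP] := per l; exists (i + p.-1) => j.
  have -> : c l (iter j F (homeo_inv (val f) y)) = c l (iter (p.-1 + j) F y).
    by rewrite -pP -iterD -{1}(prednK p0) addSn iterSr [F _](homeoVK (val f)).
  by rewrite iy addnA.
have /choice[I IP] : forall lx : nat * X, exists i, itin lx.1 i lx.2.
  by move=> [l x]; exact: itin_ex.
pose d l x := I (l, x) %% M l.
have itin_inj l i i' x : itin l i x -> itin l i' x -> i %% M l = i' %% M l.
  wlog ii' : i i' / i <= i'.
    move=> W; case: (leqP i i') => [|/ltnW] h ix ix'; first exact: W.
    by apply/esym; exact: W.
  move=> ix ix'; have dper : isper l (i' - i).
    move=> t; rewrite -(Mperk l i) addnAC -[in RHS](Mperk l i t).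
    have ti : i <= t + i * M l by rewrite (leq_trans (leq_pmulr i (M0 l))) // leq_addl.
    rewrite -{2}(subnKC ti) -ix ix' -addnA; congr (a l _).
    by rewrite addnA; lia.
  by apply/eqP; rewrite eq_sym eqn_mod_dvd //; exact: Mdvd.
have dP l i x : itin l i x -> d l x = i %% M l.
  by move=> ix; apply: itin_inj ix; exact: (IP (l, x)).
exists M, d; split; last first.
  move=> l x; rewrite (@dP l (I (l, x)).+1); first by rewrite /d -[in RHS]addn1 modnDml addn1.
  by move=> j; rewrite -iterSr (IP (l, x)) addSnnS.
split.
- by move=> l x; rewrite ltn_mod.
- move=> l i; rewrite openE => x /= <-; have [m mP] := itin_loc l.
  apply: filterS (co_nbhs_cell co m x) => y /= e.
  by apply: dP; apply: mP (esym e) _ _; exact: (IP (l, x)).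
- move=> l x; have Mm : M l %| M l.+1.
    by apply: Mdvd => i; have := Mper l.+1 i; rewrite /a; exact: (co_coarse co (leqnSn l)).
  rewrite (@dP l (I (l.+1, x))); first by rewrite /d modn_dvdm.
  by move=> j; apply: (co_coarse co (leqnSn l)); exact: (IP (l.+1, x)).
- move=> x y e; apply: (co_sep co) => l.
  have ca z : c l z = a l (d l z) by rewrite Mmod; have := IP (l, z) 0; rewrite addn0.
  by rewrite !ca e.
- move=> l i il; exists (iter i F point); rewrite (@dP l i) ?modn_small //.
  by move=> j; rewrite -iterD addnC.
- move=> l; apply: Mdvd => i; have := Mper l.+1 i; rewrite /a; exact: (co_coarse co (leqnSn l)).
Qed.
End Periodic.

(** * Baire category in coordinates *)

Section Category.
Context (R : realType) (X : ptopologicalType) (K : set (probability (borel X) R)).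
Context (N : nat -> nat) (c : nat -> X -> nat).
Hypotheses (cpt : compact [set: X]) (co : coords N c).

Lemma nowhere_denseP (A : set (GKstar K)) : nowhere_dense A <->
  forall (f : GKstar K) n, exists (g : GKstar K) m, coincide c n (val f) (val g) /\
    forall h : GKstar K, coincide c m (val g) (val h) -> ~ A h.
Proof.
split=> [nA f n|nA].
  apply: contrapT => noG; suff : interior (closure A) f by rewrite nA.
  apply/(nbhs_GKstar_coincide cpt co); exists n => g fg B.
  move=> /(nbhs_GKstar_coincide cpt co)[m mB].
  apply: contrapT => AB; apply: noG; exists g, m; split=> // h /mB Bh Ah.
  by apply: AB; exists h.
apply/seteqP; split=> // f /(nbhs_GKstar_coincide cpt co)[n nf].
have [g [m [fg mA]]] := nA f n.
have [|h [Ah /mA]] := nf g fg (fun h : GKstar K => coincide c m (val g) (val h)).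
  by apply/(nbhs_GKstar_coincide cpt co); exists m.
exact.
Qed.
End Category.

(** * Odometers have a comeager conjugacy class *)

Section Euler.
Context (n : nat) (v w : 'I_n -> nat).

Lemma eq_count_perm : (forall a, \sum_i (v i == a) = \sum_i (w i == a)) ->
  exists p : 'S_n, forall i, w (p i) = v i.
Proof.
move=> vw; have /tuple_permP[p pP] : perm_eq [tuple v i | i < n] [tuple w i | i < n].
  apply/allP => a _ /=; apply/eqP.
  have cE (u : 'I_n -> nat) : count_mem a (map_tuple u (ord_tuple n)) = \sum_i (u i == a).
    by rewrite /= count_map -sum1_count big_mkcond /= big_enum.
  by rewrite !cE.
exists p => i; have /(congr1 (fun s => nth 0 s i)) := pP.
rewrite -!tnth_nth !tnth_mktuple => ->.
by [].
Qed.

(** Read each [i] as an edge from [w i] to [v i].  A permutation [p] with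
    [w (p i) = v i] is a decomposition of the graph into closed walks.  If their
    number is minimal there is only one, since exchanging the successors of two
    edges with the same endpoint on different walks merges these walks. *)
Lemma euler_cycle : (forall a, \sum_i (v i == a) = \sum_i (w i == a)) ->
  (forall p : 'S_n, (forall i, w (p i) = v i) -> forall i j, j \notin porbit p i ->
     exists x y, [/\ x \in porbit p i, y \notin porbit p i & v x = v y]) ->
  exists2 p : 'S_n, (forall i, w (p i) = v i) & forall i j, j \in porbit p i.
Proof.
move=> /eq_count_perm[p0 p0P] merge.
pose P (p : 'S_n) := [forall i, w (p i) == v i].
have Pp0 : P p0 by apply/forallP => i; rewrite p0P.
case: (@arg_minnP _ p0 P (fun p => #|porbits p|) Pp0) => p /forallP pP pmin.
have {}pP i : w (p i) = v i by exact/eqP.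
exists p => // i j; apply/negPn/negP => jn.
have [x [y [xi yi vxy]]] := merge p pP i j jn.
have := porbits_mul_tperm p x y; rewrite /=.
have /pmin : P (tperm x y * p)%g.
  apply/forallP => k; rewrite permM pP.
  by case: tpermP => [->|->|_ _]; rewrite ?vxy.
have -> : x != y by apply: contra yi => /eqP <-.
have -> : x \notin porbit p y.
  apply: contra yi; rewrite porbit_sym -!eq_porbit_mem in xi * => /eqP e.
  by move: xi; rewrite e eq_sym.
by move=> le1 e; have := leq_add le1 (leqnn true.*2); rewrite e leq_add2l.
Qed.
End Euler.

Section Density.
Context (R : realType) (X : ptopologicalType) (K : set (probability (borel X) R)).
Context (N : nat -> nat) (c : nat -> X -> nat).
Hypotheses (cpt : compact [set: X]) (co : coords N c).
Context (mu : probability (borel X) R) (Kmu : K mu) (g : GK K).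
Hypothesis (sg : steps N c g).

(** The [i]-th cell in the cyclic order of [g] is moved by a power of [g] onto the
    [i]-th cell in the cyclic order of [p]. *)
Lemma permute_cells l (p : 'S_(N l)) : (forall i j, j \in porbit p i) ->
  exists h : GK K, forall x (i : 'I_(N l)), c l (h x) = i ->
    c l (h (g x)) = p i.
Proof.
move=> cyc; have N0 : 0 < N l by exact: leq_ltn_trans (co_lt co l point).
pose i0 := Ordinal N0; pose e i := iter i p i0.
have cardp : #|porbit p i0| = N l.
  by rewrite -[RHS]card_ord; apply: eq_card => j; rewrite cyc.
have eN : e (N l) = i0 by have := iter_porbit p i0; rewrite cardp.
have e_inj i j : i < N l -> j < N l -> e i = e j -> i = j.
  have := uniq_traject_porbit p i0; rewrite cardp => u il jl eij.
  by apply/eqP; rewrite -(nth_uniq i0 _ _ u) ?size_traject // !nth_traject // -/(e i) eij.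
have e_mod i : i < N l -> e (i.+1 %% N l) = p (e i).
  rewrite -[_ < _]/(i.+1 <= N l) leq_eqVlt => /predU1P[iN|iN].
    by rewrite iN modnn -[p (e i)]/(e i.+1) iN eN.
  by rewrite modn_small.
pose k i := e i + (N l - i).
have /choice[rho rhoE] : forall i, exists h : GK K, (h : X -> X) = iter (k i) g.
  by move=> i; exact: GK_iter.
have crho x : c l (rho (c l x) x) = e (c l x).
  have xN := co_lt co l x; rewrite rhoE (steps_iter co sg) /k addnCA.
  by rewrite (subnKC (ltnW xN)) modnDr modn_small.
have e_onto (j : 'I_(N l)) : exists i, i < N l /\ e i = j.
  have := cyc i0 j; rewrite porbit_traject cardp => /trajectP[i il ->].
  by exists i.
have /choice[d dP] : forall y, exists i, i < N l /\ e i = c l y :> nat.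
  move=> y; have [i [il ei]] := e_onto (Ordinal (co_lt co l y)).
  by exists i; rewrite ei.
pose s x := rho (c l x) x; pose s' y := homeo_inv (rho (d y)) y.
have sK : cancel s s'.
  move=> x; rewrite /s' (_ : d (s x) = c l x) ?homeoK //.
  have [dN de] := dP (s x); apply: e_inj (dN) (co_lt co l x) _.
  by apply: val_inj; rewrite /= de crho.
have s'K : cancel s' s.
  move=> y; rewrite /s (_ : c l (s' y) = d y) ?homeoVK //.
  have [dN de] := dP y; have dkN : (d y + k (d y)) %% N l = e (d y).
    by rewrite /k addnCA (subnKC (ltnW dN)) modnDr modn_small.
  suff : c l (s' y) = d y %[mod N l] by rewrite !modn_small ?(co_lt co).
  apply/eqP; rewrite -(eqn_modDr (k (d y))) dkN de -(steps_iter co sg) -rhoE.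
  by rewrite homeoVK.
have [|h [hE _]] := GK_piecewise cpt co sK s'K (co_lt co l) (fun _ _ => id) (rho := rho).
  by [].
exists h => x i; rewrite hE /s !crho => /val_inj <-.
by rewrite sg e_mod ?(co_lt co).
Qed.

(** Each cell of a fine level [l] is an edge leading from the name, at level [n],
    of its preimage under [f] to its own name.  Preservation of [mu] makes this
    graph balanced and the absence of invariant clopen sets makes it connected; an
    Eulerian circuit gives the order in which the conjugate of [g] visits the
    cells. *)
Lemma conj_dense (f : GKstar K) n :
  exists h : GK K, coincide c n (val f) (h * g * h^-1)%g.
Proof.
have [m mP] := co_continuous_uniform cpt co (homeoV_cont (val f)) n.
pose l := maxn n m.
have nl x y : c l x = c l y -> c n x = c n y by exact: (co_coarse co (leq_maxl _ _)).
have ml x y : c l x = c l y -> c n (homeo_inv (val f) x) = c n (homeo_inv (val f) y).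
  by move=> e; apply: mP; exact: (co_coarse co (leq_maxr _ _) e).
have /choice[r rP] : forall i : 'I_(N l), exists x, c l x = i.
  by move=> i; exact: (co_onto co (ltn_ord i)).
pose v i := c n (r i); pose w i := c n (homeo_inv (val f) (r i)).
pose idx x := Ordinal (co_lt co l x).
have vE x : c n x = v (idx x) by apply: nl; rewrite rP.
have wE x : c n (homeo_inv (val f) x) = w (idx x) by apply: ml; rewrite rP.
have gmu A : borelset A -> msr mu (g @^-1` A) = msr mu A by exact: GK_msr.
have vw a : \sum_i (v i == a) = \sum_i (w i == a).
  pose A := [set x | c n x = a].
  have lA x y : c l x = c l y -> A x -> A y by move=> /nl e; rewrite /A /mkset e.
  have bA : borelset A := co_borelset cpt co lA.
  have lfA x y : c l x = c l y -> (homeo_inv (val f) @^-1` A) x -> (homeo_inv (val f) @^-1` A) y.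
    by move=> /ml e; rewrite /A /preimage /mkset e.
  have := GK_msrV (val f) Kmu bA.
  rewrite (msr_count cpt co sg gmu lA) (msr_count cpt co sg gmu lfA).
  have N0 : ((N l)%:R != 0 :> R)%R.
    by rewrite pnatr_eq0 -lt0n; exact: leq_ltn_trans (co_lt co l point).
  have cnt (B : set X) (u : 'I_(N l) -> nat) : (forall x, B x <-> u (idx x) = a) ->
      \sum_(i < N l) `[<exists x, c l x = i /\ B x>] = \sum_i (u i == a).
    move=> BE; apply: eq_bigr => i _; congr nat_of_bool.
    apply/asboolP/eqP => [[x [xi /BE <-]]|ua]; first by congr u; exact: val_inj.
    exists (r i); split=> //; apply/BE; rewrite -ua; congr u; apply: val_inj; exact: rP.
  rewrite (cnt A v) => [|x]; last by rewrite -vE.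
  rewrite (cnt _ w) => [|x]; last by rewrite -wE.
  by move/(mulIf (invr_neq0 N0))/eqP; rewrite eqr_nat => /eqP.
have [|p pP cyc] := euler_cycle vw.
  move=> p pP i j jn; apply: contrapT => nmerge.
  have merge x y : x \in porbit p i -> v x = v y -> y \in porbit p i.
    by move=> xi vxy; apply: contrapT => /negP yi; apply: nmerge; exists x, y.
  (* If no two walks met, the cells on one walk would form an invariant set. *)
  pose U := [set x | idx x \in porbit p i].
  have /set_mem/(_ U) := valP f; apply.
  - apply/(co_clopen cpt co); exists l => x y e; rewrite /U /=.
    by rewrite (_ : idx x = idx y) //; exact: val_inj.
  - by exists (r i); rewrite /U /= (_ : idx (r i) = i) ?porbit_id //; apply: val_inj; exact: rP.
  - have := jn; rewrite (_ : j = idx (r j)); last by apply: val_inj; rewrite /= rP.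
    by move=> /[swap] UT; apply/negP/negPn; rewrite -[is_true _]/(U (r j)) UT.
  rewrite homeo_image.
  have pO y : (p y \in porbit p i) = (y \in porbit p i).
    by have := porbit_perm p 1 y; rewrite expg1 -!eq_porbit_mem => ->.
  suff UE x : (idx (homeo_inv (val f) x) \in porbit p i) = (idx x \in porbit p i).
    by apply/seteqP; split=> x; rewrite /U /= UE.
  have vp : v (idx (homeo_inv (val f) x)) = v (p^-1%g (idx x)).
    by rewrite -vE wE -pP permKV.
  rewrite -[idx x in RHS](permKV p) pO.
  by apply/idP/idP => xi; apply: merge xi _.
have [h hP] := permute_cells cyc; exists h => x.
have -> : homeo_inv (h * g * h^-1)%g x = h (homeo_inv g (homeo_inv h x)) by [].
set z := homeo_inv g _; have xE : x = h (g z) by rewrite /z !homeoVK.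
have hz : idx (h (g z)) = p (idx (h z)) by apply: val_inj; exact: hP.
by rewrite vE [in RHS]xE wE hz pP.
Qed.
End Density.

Section Conjugates.
Context (R : realType) (X : ptopologicalType) (K : set (probability (borel X) R)).

Lemma conj_GKstar (f : GKstar K) (h : GK K) : GKstar K (h * val f * h^-1)%g.
Proof.
move=> U cU [x Ux] UT e; have /set_mem fP := valP f.
have cV := homeo_clopen h cU; apply: (fP _ cV).
- by exists (homeo_inv h x); rewrite /= homeoVK.
- move=> VT; apply: UT; apply/seteqP; split=> // y _.
  have : (h @^-1` U) (homeo_inv h y) by rewrite VT.
  by rewrite /= homeoVK.
apply/seteqP; split=> [_ [y Uy <-]|y Uy].
  by rewrite /= -e; exists (h y) => //=; rewrite homeoK.
have [z Uz ez] : ((h * val f * h^-1)%g @` U) (h y) by rewrite e.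
exists (homeo_inv h z); first by rewrite /= homeoVK.
exact: (can_inj (homeoK h) ez).
Qed.

Lemma iter_homeoK (f : homeo X X) n : cancel (iter n f) (iter n (homeo_inv f)).
Proof. by elim: n => // n IH x; rewrite iterSr /= homeoK. Qed.

Lemma iter_homeoVK (f : homeo X X) n : cancel (iter n (homeo_inv f)) (iter n f).
Proof. exact: (iter_homeoK (homeo_sym f)). Qed.

Lemma conj_iterV (f h : GK K) n x :
  iter n (homeo_inv (h * f * h^-1)%g) x = h (iter n (homeo_inv f) (homeo_inv h x)).
Proof.
elim: n => [|n IH]; first by rewrite /= homeoVK.
by rewrite iterS IH /= homeoK.
Qed.
End Conjugates.

Section OdometerComeager.
Context (R : realType) (X : ptopologicalType) (K : set (probability (borel X) R)).
Context (N : nat -> nat) (c : nat -> X -> nat).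
Hypotheses (cpt : compact [set: X]) (co : coords N c).

Lemma steps_GKstar (g : GK K) : steps N c g -> GKstar K g.
Proof.
move=> sg U /(co_clopen cpt co)[l lU] [x Ux] UT gU; apply: UT.
apply/seteqP; split=> // y _.
have Ui n : U (iter n g x) by elim: n => // n IH; rewrite -gU; exists (iter n g x).
apply: lU (Ui (N l - c l x + c l y)); rewrite (steps_iter co sg) addnA.
by rewrite (subnKC (ltnW (co_lt co l x))) modnDl modn_small ?(co_lt co).
Qed.

Lemma steps_periodicV (g : GK K) l x : steps N c g ->
  c l (iter (N l) (homeo_inv g) x) = c l x.
Proof.
move=> sg; rewrite -[in RHS](iter_homeoVK g (N l) x) (steps_iter co sg).
by rewrite modnDr modn_small ?(co_lt co).
Qed.

(** Comparing masses of cells shows that the moduli of [c] and [d] are cofinal, so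
    [f] also adds 1 in coordinates with the moduli of [c].  The homeomorphism that
    matches these with [c] preserves the mass of cells, hence all of [K]. *)
Lemma steps_conj_class (f g : GK K) M d : K !=set0 -> coords M d ->
  steps N c g -> steps M d f -> exists h : GK K, f = (h * g * h^-1)%g.
Proof.
move=> [mu Kmu] cd sg sf.
have gmu A : borelset A -> msr mu (g @^-1` A) = msr mu A by exact: GK_msr.
have fmu A : borelset A -> msr mu (f @^-1` A) = msr mu A by exact: GK_msr.
have [d' cd' sd'] := co_regrade point cd (co_dvd co)
  (steps_dvd cpt co cd sg sf gmu fmu) (steps_dvd cpt cd co sf sg fmu gmu).
have [h hP hgf] := steps_conj cpt cpt co cd' sg (sd' _ sf).
suff hK nu : K nu -> invariant_measure h nu.
  exists (MkGK hK); apply: GK_eq => x /=.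
  by rewrite -[RHS]/((h \o g) _) hgf /= homeoVK.
move=> Knu; apply: (invariant_measure_clopen cpt co) => A cA.
have gnu B : borelset B -> msr nu (g @^-1` B) = msr nu B by exact: GK_msr.
have fnu B : borelset B -> msr nu (f @^-1` B) = msr nu B by exact: GK_msr.
have /(co_clopen cpt cd')[l lA] := cA.
have lhA x y : c l x = c l y -> (h @^-1` A) x -> (h @^-1` A) y.
  by move=> e; apply: lA; rewrite !hP.
rewrite (msr_count cpt co sg gnu lhA) (msr_count cpt cd' (sd' _ sf) fnu lA).
congr (_%:R / _)%R; apply: eq_bigr => i _; congr nat_of_bool.
apply/asboolP/asboolP => -[x [<- Ax]]; first by exists (h x); rewrite hP.
by exists (homeo_inv h x); rewrite -hP /= homeoVK.
Qed.

(** The class is the set of the maps a power of which fixes every cell of level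
    [l], for each [l]. *)
Lemma odometer_comeager (g : GKstar K) : K !=set0 -> steps N c (val g) ->
  comeager (conj_class g).
Proof.
move=> K0 sg.
pose O l : set (GKstar K) := fun f : GKstar K =>
  exists2 p, 0 < p & forall x, c l (iter p (homeo_inv (val f)) x) = c l x.
have N0 l : 0 < N l by exact: leq_ltn_trans (co_lt co l point).
have conjO l (h : GK K) : exists2 p, 0 < p &
    forall x, c l (iter p (homeo_inv (h * val g * h^-1)%g) x) = c l x.
  have [m mP] := co_continuous_uniform cpt co (homeo_cont h) l.
  exists (N m) => // x; rewrite conj_iterV -[in RHS](homeoVK h x).
  by apply: mP; rewrite steps_periodicV.
exists (fun l => ~` O l); split=> [l|].
  apply/(nowhere_denseP cpt co) => f n.
  have [mu Kmu] := K0; have [h hP] := conj_dense cpt co Kmu sg f n.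
  have [p p0 pP] := conjO l h; have [m mP] := coincide_iterV cpt co l p (h * val g * h^-1)%g.
  exists (exist (fun u => u \in GKstar K) _ (mem_set (@conj_GKstar _ _ K g h))), m.
  by split=> // f' /mP ff'; apply; exists p => // x; rewrite ff'.
rewrite -setC_bigcap; congr (~` _); apply/seteqP; split=> f.
  by move=> [h fE] l _; rewrite /O fE; exact: conjO.
move=> fO; have [|M [d [cd sf]]] := periodic_coords cpt co (f := f).
  move=> l; have [p p0 pP] := fO l I; exists p => // x.
  by rewrite -[LHS]pP iter_homeoK.
exact: steps_conj_class cd sg sf.
Qed.
End OdometerComeager.

Lemma unique_odometer_comeager (R : realType) (X : ptopologicalType)
    (K : set (probability (borel X) R)) (mu : probability (borel X) R) (g : X -> X) :
  compact [set: X] -> K = [set nu : probability (borel X) R | measure_eq nu mu] ->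
  is_odometer g -> invariant_measure g mu ->
  exists g' : GKstar K, (val g' : X -> X) = g /\ comeager (conj_class g').
Proof.
move=> cpt KE /odometer_steps[k k2 [c co sg]] gmu.
have [h gh] := steps_homeo cpt co sg.
have hK nu : K nu -> invariant_measure h nu.
  rewrite KE => numu A mA; rewrite gh in gmu.
  exact: (etrans (numu _ (homeo_measurable h mA)) (etrans (gmu A mA) (esym (numu A mA)))).
pose G := MkGK hK; have sG : steps (radix k) c G by rewrite /= -gh.
exists (exist (fun u => u \in GKstar K) G (mem_set (steps_GKstar cpt co sG))); split=> //.
apply: (odometer_comeager cpt co) => //; exists mu; rewrite KE.
by [].
Qed.

(** * The Baire property of the space of maps without invariant clopen sets *)

Section Baire.
Context (R : realType) (X : ptopologicalType) (K : set (probability (borel X) R)).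
Context (N : nat -> nat) (c : nat -> X -> nat).
Hypotheses (cpt : compact [set: X]) (co : coords N c).

Lemma limit_cancel (a b : X -> X) (u v : nat -> X -> X) :
  (forall k, continuous (v k)) -> (forall k, cancel (u k) (v k)) ->
  (forall k x, c k (a x) = c k (u k x)) -> (forall k x, c k (b x) = c k (v k x)) ->
  (forall k j x, k <= j -> c k (u j x) = c k (u k x)) ->
  (forall k j x, k <= j -> c k (v j x) = c k (v k x)) -> cancel a b.
Proof.
move=> vc uK aE bE uc vcc x; apply: (co_sep co) => k.
have [m mP] := co_continuous_uniform cpt co (vc k) k.
rewrite bE (mP _ (u (maxn m k) x)) ?aE ?uc ?leq_maxl //.
by rewrite -(vcc _ (maxn m k)) ?leq_maxr // uK.
Qed.

(** Maps and inverses have to converge together for the limit to be invertible. *)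
Lemma GKstar_limit (u : nat -> GKstar K) :
  (forall k j x, k <= j -> c k (val (u j) x) = c k (val (u k) x)) ->
  (forall k j x, k <= j ->
     c k (homeo_inv (val (u j)) x) = c k (homeo_inv (val (u k)) x)) ->
  exists f : GKstar K, forall k x, c k (homeo_inv (val f) x) = c k (homeo_inv (val (u k)) x).
Proof.
move=> uc vc.
have /choice[a aE] : forall x, exists y, forall k, c k y = c k (val (u k) x).
  move=> x; apply: (co_onto_seq cpt co) => k; first exact: (co_lt co).
  by rewrite -(co_mod co) uc.
have /choice[b bE] : forall x, exists y, forall k, c k y = c k (homeo_inv (val (u k)) x).
  move=> x; apply: (co_onto_seq cpt co) => k; first exact: (co_lt co).
  by rewrite -(co_mod co) vc.
have aK : cancel a b.
  apply: (@limit_cancel a b (fun k => val (u k)) (fun k => homeo_inv (val (u k)))) => // k.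
    exact: homeoV_cont.
  exact: homeoK.
have bK : cancel b a.
  apply: (@limit_cancel b a (fun k => homeo_inv (val (u k))) (fun k => val (u k))) => // k.
    exact: homeo_cont.
  exact: homeoVK.
have ac : continuous a.
  apply: (co_continuous cpt co) => k x.
  have : nbhs x [set y | c k (val (u k) y) = c k (val (u k) x)].
    exact: (homeo_cont (val (u k)) x _ (co_nbhs_cell co k _)).
  by apply: filterS => y /= e; rewrite !aE.
have bc : continuous b.
  apply: (co_continuous cpt co) => k x.
  have : nbhs x [set y | c k (homeo_inv (val (u k)) y) = c k (homeo_inv (val (u k)) x)].
    exact: (homeoV_cont (val (u k)) x _ (co_nbhs_cell co k _)).
  by apply: filterS => y /= e; rewrite !bE.
pose h := Homeo aK bK ac bc.
have hK mu : K mu -> invariant_measure h mu.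
  move=> Kmu; apply: (invariant_measure_clopen cpt co) => A /[dup] cA /(co_clopen cpt co)[l lA].
  rewrite -(GK_msr (val (u l)) Kmu (clopen_borelset cA)); congr (msr mu _).
  by apply/seteqP; split=> x /=; apply: lA; rewrite aE.
have hS : GKstar K (MkGK hK).
  move=> U /[dup] cU /(co_clopen cpt co)[l lU] U0 UT hU.
  have /set_mem/(_ U cU U0 UT) := valP (u l); apply; rewrite -[RHS]hU !homeo_image.
  by apply/seteqP; split=> x /=; apply: lU; rewrite bE.
by exists (exist (fun f => f \in GKstar K) _ (mem_set hS)).
Qed.

(** Nested neighbourhoods avoiding the given sets, as for complete metric spaces.
    A neighbourhood controls the inverses only, so each step also freezes the
    values of the maps at one more level. *)
Theorem GKstar_baire : GKstar K !=set0 -> ~ meager [set: GKstar K].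
Proof.
move=> [g0 g0S] [F [nF FT]].
pose good k (s t : GKstar K * nat) := [/\ coincide c s.2 (val s.1) (val t.1),
  s.2 <= t.2, k <= t.2,
  (forall g : GKstar K, coincide c t.2 (val t.1) (val g) -> ~ F k g) &
  (forall g : GKstar K, coincide c t.2 (val t.1) (val g) ->
     forall x, c k (val g x) = c k (val t.1 x))].
have /choice[step stepP] : forall ks : nat * (GKstar K * nat), exists t, good ks.1 ks.2 t.
  move=> [k [f n]] /=; have [g [m [fg mF]]] := (nowhere_denseP cpt co (F k)).1 (nF k) f n.
  have [m' m'P] := coincide_forward cpt co k (val g).
  exists (g, maxn (maxn n k) (maxn m m')); split => //=.
  - by rewrite -maxnA leq_maxl.
  - by rewrite (leq_trans (leq_maxr n k)) ?leq_maxl.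
  - move=> h gh; apply: mF; apply: (coincide_le co _ gh) => /=.
    by rewrite (leq_trans (leq_maxl m m')) ?leq_maxr.
  - move=> h gh; apply: m'P; apply: (coincide_le co _ gh) => /=.
    by rewrite (leq_trans (leq_maxr m m')) ?leq_maxr.
pose st := fix st k := if k is k'.+1 then step (k', st k')
  else (exist (fun f => f \in GKstar K) _ (mem_set g0S) : GKstar K, 0).
have stP k : good k (st k) (st k.+1) by exact: (stepP (k, st k)).
have stn j k : k <= j -> (st k).2 <= (st j).2.
  move=> /subnK <-; elim: (j - k) => // i IH; rewrite addSn.
  by apply: leq_trans IH _; have [] := stP (i + k).
have stc j k : k <= j -> coincide c (st k).2 (val (st k).1) (val (st j).1).
  move=> kj; rewrite -(subnK kj); elim: (j - k) => [|i IH]; first exact: coincide_refl.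
  rewrite addSn; apply: coincide_trans IH _; have [+ _ _ _ _] := stP (i + k).
  by apply: (coincide_le co); rewrite stn // leq_addl.
have kn k : k <= (st k.+1).2 by have [] := stP k.
have [||f fP] := @GKstar_limit (fun k => (st k.+1).1).
- by move=> k j x kj; have [_ _ _ _] := stP k; apply; exact: stc.
- by move=> k j x kj; apply: (coincide_le co (kn k)); exact: stc.
suff : (\bigcup_n F n) f -> False by apply; rewrite -FT.
move=> [k _]; have [_ _ _ + _] := stP k; apply=> x.
set n := (st k.+1).2; rewrite fP.
by apply: (stc n.+1 k.+1); rewrite ltnS kn.
Qed.
End Baire.

(** * From periodicity to odometers *)

(** The [N n] cells of a level of [c] are separated by some level of [d]. *)
Lemma co_unbounded (T : topologicalType) N (c : nat -> T -> nat) M (d : nat -> T -> nat) : compact [set: T] ->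
  (forall n, n < N n) -> coords N c -> coords M d -> forall n, exists m, n < M m.
Proof.
move=> cpt Nn cc cd n.
have [m mP] := co_uniform cpt cd (co_nbhs_cell cc n).
have /choice[r rP] : forall i : 'I_n.+1, exists x, c n x = i.
  by move=> i; apply: (co_onto cc); exact: leq_ltn_trans (leq_ord i) (Nn n).
exists m; pose e i := Ordinal (co_lt cd m (r i)).
rewrite -[n.+1]card_ord -[M m]card_ord; apply: (@leq_card _ _ e) => i j.
by move=> /(congr1 val) /mP; rewrite !rP; exact: val_inj.
Qed.

(** Passing to a subsequence of levels along which the moduli increase strictly,
    their successive quotients are the bases of an odometer. *)
Lemma steps_radix (T : topologicalType) (x0 : T) M (d : nat -> T -> nat) (g : T -> T) : coords M d ->
  (forall n, exists m, n < M m) -> steps M d g ->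
  exists2 k, (forall i, 2 <= k i) &
  exists2 d', coords (radix k) d' & steps (radix k) d' g.
Proof.
move=> cd Mub sg.
have M0 l : 0 < M l by exact: leq_ltn_trans (co_lt cd l x0).
have /choice[nx nxP] : forall na : nat * nat, exists m, na.2 <= m /\ na.1 < M m.
  move=> [n a] /=; have [m nm] := Mub n; exists (maxn a m); split; first exact: leq_maxl.
  by apply: leq_trans nm _; apply: dvdn_leq => //; apply: (co_dvd_le cd); exact: leq_maxr.
pose t := fix t l := if l is l'.+1 then nx (M (t l'), (t l').+1) else nx (1, 0).
have tlt l : t l < t l.+1 by have [] := nxP (M (t l), (t l).+1).
have Mlt l : M (t l) < M (t l.+1) by have [] := nxP (M (t l), (t l).+1).
have lt l : l <= t l by elim: l => // l IH; exact: leq_ltn_trans IH (tlt l).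
pose N l := if l is l'.+1 then M (t l') else 1.
have N0 l : 0 < N l by case: l => //= l; exact: M0.
have Ndvd l : N l %| N l.+1.
  by case: l => [|l] /=; rewrite ?dvd1n // (co_dvd_le cd) // ltnW.
have Nlt l : N l < N l.+1.
  by case: l => [|l] /=; [have [] := nxP (1, 0)|].
pose k l := N l.+1 %/ N l.
have k2 l : 2 <= k l.
  by rewrite ltnNge -ltnS; apply/negP => k1; have := Nlt l;
    rewrite -(divnK (Ndvd l)) -/(k l); case: (k l) k1 => [|[|]] //; rewrite ?mul0n ?mul1n ?ltnn.
have kN : radix k = N.
  by apply/funext; elim=> [|l IH]; rewrite ?radix0 // radixS IH mulnC divnK.
have [|l|m|d' cd' sd'] := @co_regrade _ x0 _ _ N cd.
- exact: Ndvd.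
- by case: l => [|l]; [exists 0; rewrite dvd1n|exists (t l)].
- by exists m.+1; apply: (co_dvd_le cd).
by exists k => //; rewrite kN; exists d' => //; exact: sd'.
Qed.

Lemma steps_uniquely_ergodic (R : realType) (X : ptopologicalType) N (c : nat -> X -> nat) (g : homeo X X)
    (mu nu : probability (borel X) R) : compact [set: X] -> coords N c -> steps N c g ->
  invariant_measure g mu -> invariant_measure g nu -> measure_eq nu mu.
Proof.
move=> cpt co sg gmu gnu; apply: (measure_eq_cells cpt co) => l i il.
have mi := @msr_invariant _ _ g mu _ gmu; have ni := @msr_invariant _ _ g nu _ gnu.
by rewrite (msr_cell cpt co sg mi il) (msr_cell cpt co sg ni il).
Qed.

Lemma steps_simplex_singleton (R : realType) (X : ptopologicalType)
    (K : set (probability (borel X) R)) N (c : nat -> X -> nat) (g : GK K) :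
  compact [set: X] -> coords N c -> steps N c g -> K !=set0 -> convex_measures K ->
  exists2 mu : probability (borel X) R, K = [set nu : probability (borel X) R | measure_eq nu mu] &
    unique_invariant_measure g mu.
Proof.
move=> cpt co sg [mu Kmu] convK.
have gK nu : K nu -> invariant_measure g nu by exact: GK_invariant.
have uniq := steps_uniquely_ergodic cpt co sg (gK _ Kmu).
exists mu; last by split; [exact: gK|exact: uniq].
apply/seteqP; split=> nu => [/gK|numu]; first exact: uniq.
(* Convexity also makes [K] insensitive to the values outside Borel sets. *)
apply: (convK mu mu nu 1%R) => //; first by rewrite ler01 lexx.
by move=> A mA; rewrite subrr mul0e adde0 mul1e; exact: numu.
Qed.

(** * Recurrence *)

Section Recurrence.
Context (R : realType) (X : ptopologicalType) (K : set (probability (borel X) R)).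
Context (N : nat -> nat) (c : nat -> X -> nat).
Hypotheses (cpt : compact [set: X]) (co : coords N c) (Nlt : forall n, n < N n).
Context (mu : probability (borel X) R) (Kmu : K mu).
Hypothesis mu_pos : forall A : set X, clopen A -> A !=set0 -> (0 < msr mu A)%R.
Context (F : GK K).
Hypothesis F_noinv : forall U : set X, clopen U -> U !=set0 -> F @^-1` U = U -> U = setT.

Lemma iter_borelset n A : borelset A -> borelset (iter n F @^-1` A).
Proof. by have [g <-] := GK_iter F n; exact: GK_borelset. Qed.

Lemma iter_msr n A : borelset A -> msr mu (iter n F @^-1` A) = msr mu A.
Proof. by have [g <-] := GK_iter F n; exact: GK_msr. Qed.

Lemma iter_clopen n (A : set X) : clopen A -> clopen (iter n F @^-1` A).
Proof. by have [g <-] := GK_iter F n; exact: homeo_clopen. Qed.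

(** Poincare recurrence: the preimages of [E] under the multiples of [p0.+1] have
    the same positive mass, so two of them meet. *)
Lemma recurrence (E : set X) p0 : clopen E -> E !=set0 ->
  exists2 p, p0 <= p & exists2 y, E y & E (iter p F y).
Proof.
move=> cE E0; apply: contrapT => nrec; have bE := clopen_borelset cE.
pose A j := iter (j * p0.+1) F @^-1` E.
have disj i j x : i < j -> A i x -> A j x -> False.
  move=> ij Ai Aj; apply: nrec; exists ((j - i) * p0.+1).
    by apply: leq_trans (leqnSn p0) _; rewrite leq_pmull // subn_gt0.
  by exists (iter (i * p0.+1) F x) => //; rewrite -iterD -mulnDl subnK // ltnW.
have small J : (J%:R * msr mu E <= 1)%R.
  rewrite -[leRHS](msrT mu) mulr_natl -[X in (_ *+ X)%R]card_ord -sumr_const.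
  rewrite (eq_bigr (fun j : 'I_J => msr mu (A j))) => [|j _]; last by rewrite iter_msr.
  apply: (@msr_packing _ _ mu J A setT) => //; first exact: measurableT.
  - by move=> j _; rewrite /A; exact: iter_borelset.
  - by move=> i j x _ _ Ai Aj; case: (ltngtP i j) => // /disj; [move/(_ x Ai Aj)|move/(_ x Aj Ai)].
have E_pos := mu_pos cE E0; have := small (Num.truncn (msr mu E)^-1).+1.
apply/negP; rewrite -ltNge -ltr_pdivrMr // div1r.
exact: truncnS_gt.
Qed.

Lemma multiple_recurrence (E : set X) b n : clopen E -> E !=set0 ->
  exists E' (r : nat -> nat), [/\ clopen E', E' !=set0, r 0 = 0,
    forall i, i < n -> r i + b <= r i.+1 &
    forall y i, E' y -> i <= n -> E (iter (r i) F y)].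
Proof.
move=> cE E0; elim: n => [|n [E' [r [cE' E'0 r0 rb E'E]]]].
  by exists E, (fun=> 0); split => // y i Ey _.
have [p rp [y Ey Epy]] := recurrence (r n + b) cE' E'0.
exists (E' `&` iter p F @^-1` E'), (fun i => if i <= n then r i else p); split.
- by apply: clopenI => //; exact: iter_clopen.
- by exists y.
- by [].
- move=> i; rewrite ltnS => ilen; rewrite ilen; case: ltnP => [/rb//|ni].
  by have -> : i = n by apply/eqP; rewrite eqn_leq ilen.
- move=> z i [Ez Epz]; rewrite leq_eqVlt ltnS => /predU1P[->|ilen].
    by rewrite ltnn; have := E'E _ 0 Epz (leq0n n); rewrite r0.
  by rewrite ilen; exact: E'E.
Qed.

(** The number of cells exceeds the length of any given list of points. *)
Lemma coords_infinite (s : seq X) : exists y, y \notin s.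
Proof.
pose l := size s; have : exists2 i, i < N l & i \notin map (c l) s.
  apply: contrapT => nex.
  have sub : {subset iota 0 (N l) <= map (c l) s}.
    move=> i; rewrite mem_iota /= => il; apply/negPn/negP => ni.
    by apply: nex; exists i.
  have := uniq_leq_size (iota_uniq 0 (N l)) sub.
  by rewrite size_iota size_map leqNgt Nlt.
move=> [i /(co_onto co)[y yi] ni]; exists y; apply: contra ni => ys.
by rewrite -yi map_f.
Qed.

(** Otherwise the power [T`!] of [F] is the identity on [E].  The finite orbit of a
    small clopen neighbourhood of [x] in [E] is then an invariant clopen set, and it
    misses a point chosen outside the orbit of [x]. *)
Lemma aperiodic_point (E : set X) T : clopen E -> E !=set0 ->
  exists2 x, E x & forall t, 0 < t < T -> iter t F x <> x.
Proof.
move=> cE [x Ex]; apply: contrapT => nex.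
have per y : E y -> exists2 t, 0 < t < T & iter t F y = y.
  move=> Ey; apply: contrapT => ny; apply: nex; exists y => // t tT e.
  by apply: ny; exists t.
have fac t : 0 < t < T -> t %| T`!.
  by move=> /andP[t0 tT]; apply: dvdn_fact; rewrite t0 ltnW.
have perT y : E y -> iter T`! F y = y.
  move=> /per[t /fac/dvdnP[k ->] e]; rewrite iterM.
  by elim: k => //= k ->.
have [y] := coords_infinite [seq iter t (homeo_inv F) x | t <- iota 0 T`!].
move=> /mapP yP.
pose ix t := iter t F y.
have ixn t : t < T`! -> ix t <> x.
  move=> tT e; apply: yP; exists t; first by rewrite mem_iota.
  by rewrite -e /ix iter_homeoK.
have /(co_clopen cpt co)[l0 l0E] := cE.
have [m lm mP] : exists2 m, l0 <= m & forall t, t < T`! -> c m (ix t) <> c m x.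
  elim: T`! ixn => [|k IH] ixn; first by exists l0.
  have [|m lm mP] := IH; first by move=> t tk; exact: ixn (ltnW tk).
  have [l lP] : exists l, c l (ix k) <> c l x.
    by apply/existsNP => e; apply: (ixn k) => //; exact: (co_sep co).
  exists (maxn m l); first by rewrite leq_max lm.
  move=> t; rewrite ltnS leq_eqVlt => /predU1P[->|/mP mt] e.
    by apply: lP; exact: (co_coarse co (leq_maxr m l)).
  by apply: mt; exact: (co_coarse co (leq_maxl m l)).
pose D := [set z | c m z = c m x].
have DE z : D z -> E z by move=> e; apply: (l0E x) => //; apply/esym/(co_coarse co lm e).
pose U := [set z | exists2 t, t < T`! & D (iter t F z)].
have UT : U = setT.
  apply: F_noinv.
  - have [a aP] := iter_uniform cpt co (homeo_cont F) m T`!.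
    apply/(co_clopen cpt co); exists a => z z' e [t tT Dt]; exists t => //.
    by rewrite /D /= -(aP _ _ e t (ltnW tT)).
  - by exists x, 0; rewrite ?fact_gt0.
  apply/seteqP; split=> z [t tT Dt].
    move: (tT); rewrite -[t < _]/(t.+1 <= _) leq_eqVlt => /predU1P[tE|tS]; last first.
      by exists t.+1; rewrite ?iterSr.
    exists 0; first exact: fact_gt0.
    have dE : D (iter T`! F z) by rewrite -tE iterSr.
    have e := can_inj (iter_homeoK F T`!) (perT _ (DE _ dE)).
    by move: dE; rewrite e.
  case: t tT Dt => [|t] tT Dt; last by exists t; [exact: ltnW|rewrite /= -iterSr].
  exists (T`!.-1); first by rewrite ltn_predL fact_gt0.
  by rewrite -iterSr prednK ?fact_gt0 // perT //; exact: DE.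
have [t tT /mP] : U y by rewrite UT.
exact.
Qed.
End Recurrence.

(** * Rearranging the levels of a tower *)

Section Tower.
Context (R : realType) (X : ptopologicalType) (K : set (probability (borel X) R)).
Context (N : nat -> nat) (c : nat -> X -> nat).
Hypotheses (cpt : compact [set: X]) (co : coords N c).
Context (F : GK K) (x : X) (T n : nat).

(** The tower over a small cell around [x]: its levels are disjoint and each lies in
    one cell of level [n]. *)
Lemma tower_exists : (forall t, 0 < t < T -> iter t F x <> x) ->
  exists m, (forall y t, c m y = c m x -> t <= T -> c n (iter t F y) = c n (iter t F x)) /\
    (forall y t, c m y = c m x -> 0 < t < T -> c m (iter t F y) <> c m x).
Proof.
move=> aper.
have [l lP] : exists l, forall t, 0 < t < T -> c l (iter t F x) <> c l x.
  elim: T aper => [|k IH] aper; first by exists 0 => t; rewrite ltn0 andbF.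
  have [|l lP] := IH; first by move=> t /andP[t0 tk]; apply: aper; rewrite t0 ltnW.
  have [->|k0] := posnP k; first by exists 0 => -[].
  have [a aP] : exists a, c a (iter k F x) <> c a x.
    by apply/existsNP => e; apply: (aper k); rewrite ?k0 //=; exact: (co_sep co).
  exists (maxn a l) => t /andP[t0]; rewrite ltnS leq_eqVlt => /predU1P[->|tk] e.
    by apply: aP; exact: (co_coarse co (leq_maxl a l)).
  by apply: (lP t); rewrite ?t0 //; exact: (co_coarse co (leq_maxr a l)).
have [a aP] := iter_uniform cpt co (homeo_cont F) (maxn l n) T.
exists (maxn a l); split=> [y t e tT|y t e tT ne].
  apply: (co_coarse co (leq_maxr l n)); apply: aP => //.
  exact: (co_coarse co (leq_maxl a l)).
apply: (lP t) => //; rewrite -[RHS](co_coarse co (leq_maxr a l) ne).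
apply: (co_coarse co (leq_maxl l n)); apply/esym/aP; last by case/andP: tT => _ /ltnW.
exact: (co_coarse co (leq_maxl a l) e).
Qed.

Context (m : nat).
Let D := [set y | c m y = c m x].
Hypothesis D_name : forall y t, D y -> t <= T -> c n (iter t F y) = c n (iter t F x).
Hypothesis D_far : forall y t, D y -> 0 < t < T -> ~ D (iter t F y).

Let G := homeo_inv F.

(** Off the tower the value is [T]. *)
Definition tower_level z := find (fun t => `[< D (iter t G z) >]) (iota 0 T).

Lemma tower_level_le z : tower_level z <= T.
Proof. by rewrite -[leqRHS](size_iota 0); exact: find_size. Qed.

Lemma tower_levelP z : tower_level z < T ->
  exists2 y, D y & z = iter (tower_level z) F y.
Proof.
move=> zT; have hz : has (fun t => `[< D (iter t G z) >]) (iota 0 T).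
  by rewrite has_find size_iota.
exists (iter (tower_level z) G z); last by rewrite iter_homeoVK.
by have /asboolP := nth_find 0 hz; rewrite nth_iota.
Qed.

Lemma tower_level_iter y t : D y -> t < T -> tower_level (iter t F y) = t.
Proof.
move=> Dy tT; set z := iter t F y.
have Dt : D (iter t G z) by rewrite iter_homeoK.
have hz : has (fun t => `[< D (iter t G z) >]) (iota 0 T).
  by apply/hasP; exists t; [rewrite mem_iota|exact/asboolP].
have lT : tower_level z < T by rewrite -[ltnRHS](size_iota 0) -has_find.
have lt : tower_level z <= t.
  rewrite leqNgt; apply/negP => tl; have := before_find 0 tl.
  by rewrite nth_iota // => /asboolP; apply.
have [y' Dy' e] := tower_levelP lT.
apply/eqP; rewrite eqn_leq lt leqNgt; apply/negP => tl.
apply: (@D_far y (t - tower_level z)) => //.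
  by rewrite subn_gt0 tl (leq_ltn_trans (leq_subr _ _)).
suff -> : iter (t - tower_level z) F y = y' by [].
by apply: (can_inj (iter_homeoK F (tower_level z))); rewrite -iterD subnKC // -e.
Qed.

(** Level [t] is moved onto level [e t] by a power of [F], so that the order of the
    levels changes but not their union. *)
Definition rearrange (e : nat -> nat) z :=
  if tower_level z < T then iter (e (tower_level z)) F (iter (tower_level z) G z) else z.

Lemma rearrange_iter e y t : D y -> t < T ->
  rearrange e (iter t F y) = iter (e t) F y.
Proof. by move=> Dy tT; rewrite /rearrange tower_level_iter // tT iter_homeoK. Qed.

Lemma rearrange_id e z : ~~ (tower_level z < T) -> rearrange e z = z.
Proof. by rewrite /rearrange => /negPf ->. Qed.

Lemma rearrangeK e e' : (forall t, t < T -> e t < T /\ e' (e t) = t) ->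
  cancel (rearrange e) (rearrange e').
Proof.
move=> ee z; have [zT|zT] := boolP (tower_level z < T); last by rewrite !rearrange_id.
have [y Dy] := tower_levelP zT; have [eT e'e] := ee _ zT.
move: zT eT e'e; set t := tower_level z => tT eT e'e ->.
by rewrite !rearrange_iter // e'e.
Qed.

Lemma rearrange_GK e e' : (forall t, t < T -> e t < T /\ e' (e t) = t) ->
  (forall t, t < T -> e' t < T /\ e (e' t) = t) ->
  exists s : GK K, (s : X -> X) = rearrange e.
Proof.
move=> ee' e'e.
have [a aP] := iter_uniform cpt co (homeoV_cont F) m T.
have labl z z' : c a z = c a z' -> tower_level z = tower_level z'.
  move=> zz'; apply: eq_in_find => t; rewrite mem_iota => /andP[_ tT].
  by rewrite /D /= (aP _ _ zz') // ltnW.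
have /choice[rho rhoE] : forall t, exists g : GK K, (g : X -> X) =
    fun z => if t < T then iter (e t) F (iter t G z) else z.
  move=> t; case: (t < T); last by exists 1%g.
  have [g1 g1E] := GK_iter F (e t); have [g2 g2E] := GK_iter (F^-1)%g t.
  by exists (g1 * g2)%g; apply/funext => z /=; rewrite g1E g2E.
have [|s [sE _]] := GK_piecewise cpt co (rearrangeK ee') (rearrangeK e'e)
    (k := T.+1) tower_level_le labl (rho := rho).
  by move=> z; rewrite rhoE.
by exists s.
Qed.

(** If the level that follows [e t] in the new order has the name of the level that
    used to follow it, [F] and its conjugate by the rearrangement have the same
    values at level [n].  The first and the last level stay in place because there
    the orbit enters and leaves the tower. *)
Lemma rearrange_coincide e : e 0 = 0 -> (forall t, t.+1 = T -> e t = t) ->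
  (forall t, t < T -> e t < T) ->
  (forall t, t.+1 < T ->
     c n (iter (e t.+1) F x) = c n (iter (e t).+1 F x)) ->
  forall z, c n (rearrange e (F z)) = c n (F (rearrange e z)).
Proof.
move=> e0 eT eltT ename z.
have out : ~~ ((tower_level z).+1 < T) -> rearrange e (F z) = F z.
  move=> zT; have [FzT|] := boolP (tower_level (F z) < T); last exact: rearrange_id.
  have [y Dy] := tower_levelP FzT; move: FzT; case: (tower_level (F z)) => [|t] tT Fz.
    by rewrite Fz rearrange_iter // e0.
  have zE : z = iter t F y by apply: (can_inj (homeoK F)); rewrite Fz.
  by move: zT; rewrite zE tower_level_iter ?tT // ltnW.
have [lT|lT] := boolP (tower_level z < T); last first.
  by rewrite out ?rearrange_id //; apply: contra lT; exact: ltnW.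
have [y Dy] := tower_levelP lT; move: lT out; set t := tower_level z => tT out zE.
have [ST|ST] := boolP (t.+1 < T); last first.
  rewrite out // [in RHS]zE rearrange_iter // eT -?zE //.
  by apply/eqP; rewrite eqn_leq tT leqNgt.
rewrite zE -iterS !rearrange_iter // -iterS !D_name ?ename //; first exact: eltT.
exact/ltnW/eltT.
Qed.

Definition pattern_set (q : X -> bool) L (W : nat -> bool) : set X :=
  [set z | forall i, i < L -> q (iter i F z) = W i].

Lemma pattern_borelset q L W : (forall y z, c n y = c n z -> q y = q z) ->
  borelset (pattern_set q L W).
Proof.
move=> qn; have [a aP] := iter_uniform cpt co (homeo_cont F) n L.
apply: (co_borelset cpt co (l := a)) => y z e yW i iL; rewrite -yW //.
by apply/qn/esym/aP => //; exact: ltnW.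
Qed.

Context (mu : probability (borel X) R) (Kmu : K mu).
Hypothesis D_pos : (0 < msr mu D)%R.

Lemma base_borelset : borelset D.
Proof. by apply: clopen_borelset; exact: (co_clopen_cell cpt co m (c m x)). Qed.

Lemma level_borelset t : borelset (iter t G @^-1` D).
Proof.
have [g gE] := GK_iter (F^-1)%g t; rewrite -[iter t G]/(iter t (F^-1)%g) -gE.
by apply: GK_borelset; exact: base_borelset.
Qed.

Lemma level_msr t : msr mu (iter t G @^-1` D) = msr mu D.
Proof.
have [g gE] := GK_iter (F^-1)%g t; rewrite -[iter t G]/(iter t (F^-1)%g) -gE.
by apply: GK_msr => //; exact: base_borelset.
Qed.

Lemma pre_level_borelset t : borelset (iter t F @^-1` D).
Proof.
have [g <-] := GK_iter F t.
by apply: GK_borelset; exact: base_borelset.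
Qed.

Lemma pre_level_msr t : msr mu (iter t F @^-1` D) = msr mu D.
Proof.
have [g <-] := GK_iter F t.
by apply: GK_msr => //; exact: base_borelset.
Qed.

(** Let [om] be the word [u v], with [u] of length [a] and [v] of length [b - a].
    Along the first [k * b] levels the order [e1] reads [u v u v ... u v] and the
    order [e2] reads [u ... u v ... v]; further levels are the same for both.  The
    pattern [u v u v] occurs in the first reading at each multiple of [b].  Inside
    a stretch with period [a] or [b - a] it would force [u v = v u], which
    the inequality at [j0] excludes.  So [e2] shows it only near the three
    places where a stretch begins or ends, and [k] is so large that [e1] shows it
    more often. *)
Lemma rearrangement_count (q : X -> bool) (om : nat -> bool) a b k j0 e1 e2 :
  (forall y z, c n y = c n z -> q y = q z) -> 0 < a < b -> k = 6 * b + 2 ->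
  k * b <= T -> j0 < b -> om ((j0 + a) %% b) <> om j0 ->
  (forall t, t < T -> e1 t < T) -> (forall t, t < T -> e2 t < T) ->
  (forall t, k * b <= t -> e1 t = e2 t) ->
  (forall t, t < k * b -> q (iter (e1 t) F x) = om (t %% b)) ->
  (forall t, t < k * a -> q (iter (e2 t) F x) = om (t %% a)) ->
  (forall t, k * a <= t < k * b ->
     q (iter (e2 t) F x) = om (a + (t - k * a) %% (b - a))) ->
  let O e := [set z | forall i, i < 2 * b -> q (rearrange e (iter i F z)) = om (i %% b)] in
  borelset (O e1) -> borelset (O e2) -> msr mu (O e1) <> msr mu (O e2).
Proof.
move=> qn /andP[a0 ab] kE kT j0b omj e1T e2T e12 H1 H2 H3 O bO1 bO2 eO.
have b0 : 0 < b by exact: leq_ltn_trans ab.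
set L := 2 * b in O bO1 bO2 eO *; set M := k * b in kT e12 H1 H3 *.
have kaM : k * a <= M by rewrite leq_mul2l (ltnW ab) orbT.
have qlev e y t : (forall t, t < T -> e t < T) -> D y -> t < T ->
    q (rearrange e (iter t F y)) = q (iter (e t) F x).
  by move=> eT Dy tT; rewrite rearrange_iter //; apply/qn/D_name => //; exact/ltnW/eT.
pose Z0 := [set z | exists2 t, t < M & D (iter t G z)].
pose good i := iter (i * b) G @^-1` D.
(* Starting points from which a pattern of length [L] enters the tower, leaves
   the stretch of period [a], or leaves the stretch of period [b - a]. *)
pose bad i := if i < L then iter i F @^-1` D
  else if i < 2 * L then iter (k * a - 1 - (i - L)) G @^-1` D
  else iter (M - 1 - (i - 2 * L)) G @^-1` D.
have bad_borel i : borelset (bad i).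
  by rewrite /bad; do 2?[case: ifP => _]; first [exact: level_borelset|exact: pre_level_borelset].
have bad_msr i : msr mu (bad i) = msr mu D.
  by rewrite /bad; do 2?[case: ifP => _]; first [exact: level_msr|exact: pre_level_msr].
have bZ0 : borelset Z0.
  have -> : Z0 = \big[setU/set0]_(t < M) (iter t G @^-1` D).
    rewrite -(bigcup_mkord M (fun t => iter t G @^-1` D)).
    by apply/seteqP; split=> z [t tM Dt]; exists t.
  by apply: bigsetU_measurable => t _; exact: level_borelset.
have goodO i : i < k.-1 -> good i `<=` O e1 `&` Z0.
  move=> ik z; rewrite /good /= => Dz; set y := iter (i * b) G z in Dz.
  have zE : z = iter (i * b) F y by rewrite iter_homeoVK.
  have ikM : i * b + L <= M.
    rewrite /L -mulnDl leq_mul2r; apply/orP; right.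
    by move: ik; rewrite kE; lia.
  split; last by exists (i * b) => //; rewrite (leq_trans _ ikM) // -addn1 leq_add2l /L; lia.
  move=> j jL; have ijM : i * b + j < M by rewrite (leq_trans _ ikM) // ltn_add2l.
  rewrite zE -iterD [j + _]addnC qlev //; last exact: leq_trans kT.
  by rewrite H1 // modnMDl.
have disjgood i j z : i < k.-1 -> j < k.-1 -> good i z -> good j z -> i = j.
  wlog ij : i j / i <= j.
    move=> W ik jk gi gj; case: (leqP i j) => [|/ltnW] h; first exact: W.
    by apply/esym; exact: W.
  move=> ik jk; rewrite /good /= => gi gj; apply/eqP; rewrite eqn_leq ij leqNgt.
  apply/negP => lt_ij; apply: (D_far gj (t := (j - i) * b)).
    rewrite muln_gt0 subn_gt0 lt_ij b0 /= (leq_trans _ kT) // ltn_mul2r b0 /=.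
    by rewrite (leq_ltn_trans (leq_subr _ _)) // (leq_trans jk) // leq_pred.
  rewrite -(subnK (ltnW lt_ij)) mulnDl addnK iterD.
  by rewrite (iter_homeoVK F ((j - i) * b)).
have nopat1 z y u : D y -> z = iter u F y -> u + L <= k * a -> ~ O e2 z.
  move=> Dy zE uL Oz.
  have om_a j : j < L -> om ((u + j) %% a) = om (j %% b).
    move=> jL; have ujM : u + j < k * a by rewrite (leq_trans _ uL) // ltn_add2l.
    rewrite -H2 // -(Oz j jL) zE -iterD [j + u]addnC qlev //.
    exact: leq_trans (leq_trans ujM kaM) kT.
  apply: omj; rewrite -(om_a (j0 + a)) /L; last lia.
  by rewrite addnA modnDr om_a /L ?modn_small //; lia.
have nopat2 z y u : D y -> z = iter u F y -> k * a <= u -> u + L <= M -> ~ O e2 z.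
  move=> Dy zE au uL Oz.
  have om_c j : j < L -> om (a + (u + j - k * a) %% (b - a)) = om (j %% b).
    move=> jL; have ujM : u + j < M by rewrite (leq_trans _ uL) // ltn_add2l.
    rewrite -H3; last by rewrite ujM (leq_trans au) // leq_addr.
    by rewrite -(Oz j jL) zE -iterD [j + u]addnC qlev // (leq_trans ujM).
  apply: omj; set j := (j0 + a) %% b; have jb : j < b by rewrite ltn_mod.
  rewrite -[in LHS](modn_small jb) -om_c /L; last lia.
  have <- : (j + (b - a)) %% b = j0.
    by rewrite modnDml -addnA subnKC ?modnDr ?modn_small // ltnW.
  rewrite -om_c /L; last lia.
  have -> : u + (j + (b - a)) - k * a = u + j - k * a + (b - a) by lia.
  by rewrite modnDr.
have O2_sub z : O e2 z -> (O e1 `\` Z0) z \/ exists2 i, i < 3 * L & bad i z.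
  move=> Oz; have [[u uM Du]|nZ] := pselect (Z0 z).
    right; have zE : z = iter u F (iter u G z) by rewrite iter_homeoVK.
    have [uka|kau] := ltnP u (k * a).
      have uL : k * a < u + L.
        by rewrite ltnNge; apply/negP => /(nopat1 z _ u Du zE); exact.
      exists (L + (k * a - 1 - u)); first lia.
      rewrite /bad ifF; last lia; rewrite ifT; last lia.
      by have -> : k * a - 1 - (L + (k * a - 1 - u) - L) = u by lia.
    have uL : M < u + L.
      by rewrite ltnNge; apply/negP => /(nopat2 z _ u Du zE kau); exact.
    exists (2 * L + (M - 1 - u)); first lia.
    rewrite /bad ifF; last lia; rewrite ifF; last lia.
    by have -> : M - 1 - (2 * L + (M - 1 - u) - 2 * L) = u by lia.
  have [[j jL Dj]|nbad] := pselect (exists2 j, j < L & D (iter j F z)).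
    by right; exists j; [lia|rewrite /bad jL].
  left; split=> // j jL; rewrite -Oz //.
  suff levM : ~~ (tower_level (iter j F z) < M).
    have [lT|lT] := boolP (tower_level (iter j F z) < T); last by rewrite !rearrange_id.
    by rewrite /rearrange lT e12 // leqNgt.
  elim: j jL => [|j IH] jL; apply/negP => lM.
    have [y Dy zE] := tower_levelP (leq_trans lM kT).
    by apply: nZ; exists (tower_level z); rewrite // [X in iter _ G X]zE iter_homeoK.
  have [y Dy] := tower_levelP (leq_trans lM kT); move: lM.
  case: (tower_level _) => [|u] uM zE; first by apply: nbad; exists j.+1 => //; rewrite zE.
  have zE' : iter j F z = iter u F y by apply: (can_inj (homeoK F)); rewrite -!iterS.
  have := IH (ltnW jL); rewrite zE' tower_level_iter ?(ltnW uM) //.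
  exact: leq_trans (ltnW uM) kT.
have le2 : (msr mu (O e2) <= msr mu (O e1 `\` Z0) + (3 * L)%:R * msr mu D)%R.
  have -> : ((3 * L)%:R * msr mu D = \sum_(i < 3 * L) msr mu (bad i))%R.
    by under eq_bigr do rewrite bad_msr; rewrite sumr_const card_ord mulr_natl.
  pose F' i := if i is i'.+1 then bad i' else O e1 `\` Z0.
  have := @msr_cover _ _ mu (3 * L).+1 F' (O e2) bO2.
  rewrite big_ord_recl /=; apply.
    by case=> [|i] _; [exact: measurableD|exact: bad_borel].
  by move=> z /O2_sub[]; [exists 0|move=> [i iL bi]; exists i.+1].
have le1 : (k.-1%:R * msr mu D <= msr mu (O e1 `&` Z0))%R.
  have -> : (k.-1%:R * msr mu D = \sum_(i < k.-1) msr mu (good i))%R.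
    by under eq_bigr do rewrite level_msr; rewrite sumr_const card_ord mulr_natl.
  apply: msr_packing => //; first exact: measurableI.
  by move=> i _; exact: level_borelset.
move: le2; rewrite -eO (msrID mu bO1 bZ0) lerD2l => /(le_trans le1).
rewrite ler_pM2r // ler_nat kE /L; lia.
Qed.
End Tower.

(** * Orders on the levels of a tower built from blocks *)

Section Blocks.
Context (r : nat -> nat).

(** With [r i] the times of the visits to a set, these are portions of the intervals
    between visits; orders on a tower are obtained by concatenating such lists. *)
Definition blocks (o : nat -> nat) (len : nat -> nat) n :=
  flatten [seq iota (r i + o i) (len i) | i <- iota 0 n].

Lemma blocksS o len n :
  blocks o len n.+1 = blocks o len n ++ iota (r n + o n) (len n).
Proof.
by rewrite /blocks -addn1 iotaD map_cat flatten_cat /= cats0 add0n.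
Qed.

Lemma size_blocks o b n : size (blocks o (fun=> b) n) = n * b.
Proof.
by elim: n => // n IH; rewrite blocksS size_cat IH size_iota mulSn addnC.
Qed.

Lemma nth_blocks o b n s t : t < n * b ->
  nth 0 (blocks (fun=> o) (fun=> b) n ++ s) t = r (t %/ b) + o + t %% b.
Proof.
move=> tn; rewrite nth_cat size_blocks tn; elim: n tn => // n IH tn.
have b0 : 0 < b by case: b tn {IH} => //; rewrite muln0.
rewrite blocksS nth_cat size_blocks; case: ifP => [/IH//|/negbT].
rewrite -leqNgt => nt; have tb : t - n * b < b by rewrite ltn_subLR // addnC -mulSn.
rewrite nth_iota //; have -> : t = n * b + (t - n * b) by rewrite subnKC.
by rewrite divnMDl // (divn_small tb) addn0 modnMDl (modn_small tb) addKn.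
Qed.

Lemma perm_blocks o len o' len' n : (forall i, o' i = o i + len i) ->
  perm_eq (blocks o (fun i => len i + len' i) n) (blocks o len n ++ blocks o' len' n).
Proof.
move=> oE; elim: n => [|n IH]; first by rewrite /blocks.
rewrite !blocksS iotaD -addnA -oE; apply/seq.permP => p; move/seq.permP: IH => /(_ p).
by rewrite !count_cat => ->; lia.
Qed.

Lemma blocks_iota len n : r 0 = 0 -> (forall i, i < n -> r i + len i = r i.+1) ->
  blocks (fun=> 0) len n = iota 0 (r n).
Proof.
move=> r0; elim: n => [|n IH] rlen; first by rewrite /blocks r0.
rewrite blocksS IH => [|i il]; last by apply: rlen; exact: ltnW.
by rewrite addn0 -rlen // iotaD.
Qed.

(** Lists with this property can be concatenated in any order without violating the
    hypothesis of [rearrange_coincide]: each begins with a level named [B] and ends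
    with a level whose successor is named [B]. *)
Definition chain (nu : nat -> nat) (B : nat) s := forall p, nu p.+1 = B ->
  path (fun i j => nu i.+1 == nu j) p s /\ nu (last p s).+1 = B.

Lemma chain_cat nu B s1 s2 : chain nu B s1 -> chain nu B s2 -> chain nu B (s1 ++ s2).
Proof.
move=> c1 c2 p /c1[p1 /c2[p2 l2]]; rewrite cat_path last_cat p1 p2.
by [].
Qed.

Lemma chain_iota nu B i len : nu i = B -> nu (i + len) = B -> chain nu B (iota i len).
Proof.
case: len => [|len] iB lB p pB; first by [].
rewrite /= pB iB eqxx /=; split.
  by elim: len i {iB lB} => //= len IH i; rewrite eqxx IH.
suff -> : last i (iota i.+1 len) = i + len by rewrite -addnS.
by elim: len i {iB lB} => [|len IH] i /=; rewrite ?addn0 // IH addSnnS.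
Qed.

Lemma chain_blocks nu B o len n : (forall i, i < n -> nu (r i + o i) = B) ->
  (forall i, i < n -> nu (r i + o i + len i) = B) -> chain nu B (blocks o len n).
Proof.
elim: n => [|n IH] h1 h2; first by move=> p pB.
rewrite blocksS; apply: chain_cat; last by apply: chain_iota; [exact: h1|exact: h2].
by apply: IH => i il; [apply: h1|apply: h2]; exact: ltnW.
Qed.
End Blocks.

(** The last level is added by hand: it has the name [B], and nothing is known about
    the name of its successor. *)
Lemma order_of_chain nu B s : chain nu B s ->
  (exists p, nu p.+1 = B) -> nu (size s) = B ->
  perm_eq (rcons s (size s)) (iota 0 (size s).+1) ->
  let e := nth 0 (rcons s (size s)) in
  [/\ forall t, t < (size s).+1 -> e t < (size s).+1 /\ index (e t) (rcons s (size s)) = t,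
      forall t, t < (size s).+1 -> index t (rcons s (size s)) < (size s).+1 /\
        e (index t (rcons s (size s))) = t,
      e (size s) = size s &
      forall t, t.+1 < (size s).+1 -> nu (e t.+1) = nu (e t).+1].
Proof.
move=> ch [p pB] sB perm e; set S := rcons s _ in perm e *.
have sS : size S = (size s).+1 by rewrite size_rcons.
have mS i : (i \in S) = (i < (size s).+1) by rewrite (perm_mem perm) mem_iota.
have uS : uniq S by rewrite (perm_uniq perm) iota_uniq.
split.
- move=> t tS; rewrite -mS mem_nth ?sS //; split=> //.
  by rewrite index_uniq ?sS.
- move=> t; rewrite -mS => tS; split; first by rewrite -sS index_mem.
  by rewrite /e nth_index.
- by rewrite /e /S nth_rcons ltnn eqxx.
- move=> t tS; have [ps ls] := ch p pB.
  have : path (fun i j => nu i.+1 == nu j) p S by rewrite rcons_path ps /= ls sB.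
  by move=> /path_sorted/(sortedP 0) h; apply/esym/eqP; apply: h; rewrite sS.
Qed.

(** * Constant statistics force periodicity *)

Section ConstantPatterns.
Context (R : realType) (X : ptopologicalType) (K : set (probability (borel X) R)).
Context (N : nat -> nat) (c : nat -> X -> nat).
Hypotheses (cpt : compact [set: X]) (co : coords N c) (Nlt : forall n, n < N n).
Context (mu : probability (borel X) R) (Kmu : K mu).
Hypothesis mu_pos : forall A : set X, clopen A -> A !=set0 -> (0 < msr mu A)%R.
Context (F : GK K).
Hypothesis F_noinv : forall U : set X, clopen U -> U !=set0 -> F @^-1` U = U -> U = setT.
Context (n : nat) (q : X -> bool) (qn : forall y z, c n y = c n z -> q y = q z).
Hypothesis pattern_const : forall s : GK K, (forall z, c n (s (F z)) = c n (F (s z))) ->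
  forall L W, msr mu [set z | forall i, i < L -> q (s (iter i F z)) = W i] =
    msr mu (pattern_set F q L W).

Lemma moved_pattern_borelset (s : GK K) L W :
  borelset [set z | forall i, i < L -> q (s (iter i F z)) = W i].
Proof.
have [m mP] := co_continuous_uniform cpt co (homeo_cont s) n.
have [a aP] := iter_uniform cpt co (homeo_cont F) m L.
apply: (co_borelset cpt co (l := a)) => y z e yW i iL; rewrite -yW //.
by apply/qn/mP/esym/aP => //; exact: ltnW.
Qed.

(** The words [u] and [v] read through [q] between the visits of [x] to its cell at
    times [0], [a] and [b] commute, hence [u v] has period [a].  Otherwise many
    occurrences of [u v] along one orbit could be reordered in two ways with
    different frequencies of [u v u v]. *)
Lemma return_words_commute x a b : 0 < a < b ->
  c n (iter a F x) = c n x -> c n (iter b F x) = c n x ->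
  forall j, j + a < b -> q (iter (j + a) F x) = q (iter j F x).
Proof.
move=> /[dup] ab0 /andP[a0 ab] xa xb; pose om j := q (iter j F x).
suff rot j : j < b -> om ((j + a) %% b) = om j.
  move=> j jab; rewrite -[RHS](rot j) ?modn_small //.
  exact: leq_ltn_trans (leq_addr a j) jab.
move=> jb; apply: contrapT => omj.
(* The set where the orbit of [x] is shadowed up to time [b]. *)
pose E := [set y | forall t, t <= b -> c n (iter t F y) = c n (iter t F x)].
have cE : clopen E.
  have [m mP] := iter_uniform cpt co (homeo_cont F) n b.
  apply/(co_clopen cpt co); exists m => y z e Ey t tb.
  by rewrite -(mP _ _ e t tb); exact: Ey.
have [E' [r [cE' E'0 r0 rb E'E]]] :=
  multiple_recurrence Kmu mu_pos F b (6 * b + 2) cE (ex_intro _ x (fun _ _ => erefl)).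
set k := 6 * b + 2 in rb E'E.
have [x' E'x' aper] := aperiodic_point cpt co Nlt F_noinv (r k).+1 cE' E'0.
have [m [D_name D_far]] := tower_exists cpt co n aper.
pose nu t := c n (iter t F x').
have nuE i t : i <= k -> t <= b -> nu (r i + t) = c n (iter t F x).
  by move=> ik tb; rewrite /nu addnC iterD; exact: E'E.
have qE i t : i <= k -> t <= b -> q (iter (r i + t) F x') = om t.
  by move=> ik tb; apply: qn; exact: nuE.
have nu0 i : i <= k -> nu (r i) = c n x by move=> ik; rewrite -[r i]addn0 nuE.
have kr i : i <= k -> i * b <= r i.
  elim: i => // i IH ik; rewrite mulSn addnC (leq_trans _ (rb i ik)) // leq_add2r.
  exact/IH/ltnW.
(* [A1] reads [u v u v ... u v] and [A2] reads [u ... u v ... v]; the times left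
   over between the visits are collected in [C]. *)
pose gap i := r i.+1 - (r i + b).
have gapE i : i < k -> r i + (b + gap i) = r i.+1.
  by move=> ik; rewrite addnA subnKC // rb.
pose C := blocks r (fun=> b) gap k.
pose A1 := blocks r (fun=> 0) (fun=> b) k.
pose A2 := blocks r (fun=> 0) (fun=> a) k ++ blocks r (fun=> a) (fun=> b - a) k.
have perm1 : perm_eq (A1 ++ C) (iota 0 (r k)).
  rewrite -(blocks_iota r0 gapE) perm_sym.
  exact: (@perm_blocks r (fun=> 0) (fun=> b) (fun=> b) gap).
have perm12 : perm_eq A2 A1.
  rewrite perm_sym; have -> : A1 = blocks r (fun=> 0) (fun=> a + (b - a)) k.
    by rewrite subnKC // ltnW.
  exact: (@perm_blocks r (fun=> 0) (fun=> a) (fun=> a) (fun=> b - a)).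
have perm2 : perm_eq (A2 ++ C) (iota 0 (r k)).
  by apply: perm_trans perm1; rewrite perm_cat2r.
have size1 : size (A1 ++ C) = r k by rewrite (perm_size perm1) size_iota.
have size2 : size (A2 ++ C) = r k by rewrite (perm_size perm2) size_iota.
have permS s : perm_eq s (iota 0 (r k)) -> perm_eq (rcons s (r k)) (iota 0 (r k).+1).
  by move=> ps; rewrite -[(r k).+1]addn1 iotaD /= add0n -cats1 perm_cat2r.
have chC : chain nu (c n x) C.
  apply: chain_blocks => i ik; first by rewrite nuE // ltnW.
  by rewrite -addnA gapE // nu0.
have ch1 : chain nu (c n x) (A1 ++ C).
  apply: chain_cat chC; apply: chain_blocks => i ik; rewrite addn0; first by rewrite nu0 // ltnW.
  by rewrite nuE // ltnW.
have ch2 : chain nu (c n x) (A2 ++ C).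
  apply: chain_cat chC; apply: chain_cat; apply: chain_blocks => i ik; rewrite ?addn0.
  - by rewrite nu0 // ltnW.
  - by rewrite nuE // ltnW.
  - by rewrite nuE // ltnW.
  - by rewrite -addnA subnKC ?nuE // ltnW.
have pred0 : exists p, nu p.+1 = c n x.
  by exists a.-1; rewrite prednK // -xa -(nuE 0) ?r0 // ltnW.
have := order_of_chain ch1 pred0; have := order_of_chain ch2 pred0.
rewrite size1 size2 nu0 // => /(_ erefl (permS _ perm2)) + /(_ erefl (permS _ perm1)).
set S2 := rcons (A2 ++ C) (r k); set S1 := rcons (A1 ++ C) (r k).
move=> /= [e2i i2e e2l e2n] [e1i i1e e1l e1n].
have k0 : 0 < k by rewrite /k addn2.
have b0 : 0 < b by exact: leq_ltn_trans ab.
have S1E t : t < k * b -> nth 0 S1 t = r (t %/ b) + t %% b.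
  by move=> tb; rewrite /S1 rcons_cat nth_blocks // addn0.
have S2E t : t < k * a -> nth 0 S2 t = r (t %/ a) + t %% a.
  by move=> ta; rewrite /S2 -catA rcons_cat nth_blocks // addn0.
have S2E' t : k * a <= t < k * b ->
    nth 0 S2 t = r ((t - k * a) %/ (b - a)) + (a + (t - k * a) %% (b - a)).
  move=> /andP[ta tb]; rewrite /S2 -catA !rcons_cat nth_cat size_blocks ltnNge ta /=.
  by rewrite nth_blocks ?addnA // mulnBr ltn_sub2r // (leq_ltn_trans ta).
have move_ok S : (forall t, t < (r k).+1 -> nth 0 S t < (r k).+1 /\ index (nth 0 S t) S = t) ->
    (forall t, t < (r k).+1 -> index t S < (r k).+1 /\ nth 0 S (index t S) = t) ->
    nth 0 S 0 = 0 -> nth 0 S (r k) = r k ->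
    (forall t, t.+1 < (r k).+1 -> nu (nth 0 S t.+1) = nu (nth 0 S t).+1) ->
    let O := [set z | forall i, i < 2 * b ->
      q (rearrange c F x' (r k).+1 m (nth 0 S) (iter i F z)) = om (i %% b)] in
    borelset O /\ msr mu O = msr mu (pattern_set F q (2 * b) (fun i => om (i %% b))).
  move=> Se Si S0 Sl Sn.
  have [s sE] := rearrange_GK cpt co D_far Se Si.
  rewrite /= -sE; split; first exact: moved_pattern_borelset.
  apply: pattern_const => z; rewrite sE.
  apply: (rearrange_coincide D_name D_far) => // [t [->]//|t /Se[]//].
have S10 : nth 0 S1 0 = 0 by rewrite S1E ?div0n ?mod0n ?r0 // muln_gt0 k0.
have S20 : nth 0 S2 0 = 0 by rewrite S2E ?div0n ?mod0n ?r0 // muln_gt0 k0.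
have [bO1 O1] := move_ok S1 e1i i1e S10 e1l e1n.
have [bO2 O2] := move_ok S2 e2i i2e S20 e2l e2n.
have ltk t d : t < k * d -> t %/ d < k.
  by move=> td; rewrite ltn_divLR //; case: d td => //; rewrite muln0.
apply: (@rearrangement_count _ _ _ _ _ cpt co F x' (r k).+1 n m D_name D_far mu Kmu _ q om
  a b k j (nth 0 S1) (nth 0 S2)) => //.
- by apply: mu_pos; [exact: (co_clopen_cell cpt co)|exists x'].
- exact/leqW/kr.
- by move=> t /e1i[].
- by move=> t /e2i[].
- move=> t kt; rewrite /S1 /S2 !rcons_cat !nth_cat size_cat !size_blocks.
  by rewrite -mulnDr subnKC ?(ltnW ab) // ltnNge kt.
- move=> t tkb; rewrite S1E // qE ?(ltnW (ltk _ _ tkb)) //.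
  exact/ltnW/ltn_pmod.
- move=> t tka; rewrite S2E // qE ?(ltnW (ltk _ _ tka)) //.
  by rewrite (leq_trans _ (ltnW ab)) // ltnW // ltn_pmod.
- move=> t /[dup] tk /andP[kat tkb]; rewrite S2E' // qE //.
    by rewrite ltnW // ltk // mulnBr ltn_sub2r // (leq_ltn_trans kat).
  by rewrite -[leqRHS](subnKC (ltnW ab)) leq_add2l ltnW // ltn_pmod // subn_gt0.
by rewrite O1 O2.
Qed.

(** Along any orbit some cell is visited twice within [N n] steps, and commutation of
    return words propagates the corresponding period up to any later visit to that
    cell.  Recurrence provides visits that are late enough. *)
Lemma constant_patterns_periodic :
  exists2 p, 0 < p & forall x, q (iter p F x) = q x.
Proof.
set p := (N n)`!; exists p; first exact: fact_gt0.
move=> x0; apply: contrapT => nx0.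
(* The window of [N n + 1] steps before [x0] contains the repeated cell. *)
pose y0 := iter (N n).+1 (homeo_inv F) x0.
have y0E : iter (N n).+1 F y0 = x0 by rewrite iter_homeoVK.
have [i [j [ij jN eij]]] : exists i j, [/\ i < j, j <= N n &
    c n (iter i F y0) = c n (iter j F y0)].
  apply: contrapT => nij.
  pose e (t : 'I_(N n).+1) := Ordinal (co_lt co n (iter t F y0)).
  have e_inj : injective e.
    move=> s t /(congr1 val) /= est; apply: val_inj => /=.
    case: (ltngtP s t) => // st; exfalso; apply: nij.
      by exists s, t; split=> //; exact: leq_ord.
    by exists t, s; split=> //; exact: leq_ord.
  by have := leq_card e e_inj; rewrite !card_ord ltnn.
set l := (N n).+1 + p.
pose E := [set y | forall t, t <= l -> c n (iter t F y) = c n (iter t F y0)].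
have cE : clopen E.
  have [m mP] := iter_uniform cpt co (homeo_cont F) n l.
  apply/(co_clopen cpt co); exists m => y z e Ey t tb.
  by rewrite -(mP _ _ e t tb); exact: Ey.
have [t lt_t [y Ey Ety]] := recurrence Kmu mu_pos F l.+1 cE (ex_intro _ y0 (fun _ _ => erefl)).
have jl : j <= l by rewrite (leq_trans jN) // /l; lia.
have il : i <= l by exact: leq_trans (ltnW ij) jl.
pose x := iter i F y.
have per s : s + (j - i) < t -> q (iter (s + (j - i)) F x) = q (iter s F x).
  apply: return_words_commute; first by rewrite subn_gt0 ij /=; lia.
    by rewrite /x -iterD subnK ?(ltnW ij) // !Ey.
  by rewrite /x -iterD addnC iterD Ety // Ey.
have /dvdnP[d dE] : j - i %| p by apply: dvdn_fact; rewrite subn_gt0 ij /=; lia.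
have perd u s : s + u * (j - i) < t -> q (iter (s + u * (j - i)) F x) = q (iter s F x).
  elim: u => [|u IH]; first by rewrite addn0.
  rewrite mulSn [j - i + _]addnC addnA => h; rewrite per // IH //.
  exact: leq_ltn_trans (leq_addr _ _) h.
apply: nx0; rewrite -y0E -iterD.
have nameE s : s <= l -> q (iter s F y) = q (iter s F y0) by move=> sl; apply/qn/Ey.
rewrite -!nameE /l ?leq_addr //; last by rewrite addnC.
have Nx s : iter ((N n).+1 + s) F y = iter ((N n).+1 - i + s) F x.
  by rewrite /x -iterD; congr (iter _ F y); lia.
rewrite [p + _]addnC Nx -[in RHS](addn0 (N n).+1) Nx addn0 dE perd //.
by rewrite -dE; move: lt_t; rewrite /l; lia.
Qed.
End ConstantPatterns.

(** * A comeager conjugacy class consists of odometers *)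

Lemma meagerU (T : topologicalType) (A B : set T) : meager A -> meager B -> meager (A `|` B).
Proof.
move=> [F [nF ->]] [G [nG ->]].
exists (fun k => if odd k then G k./2 else F k./2); split.
  by move=> k; case: ifP.
apply/seteqP; split=> x.
  by move=> [[k _ Fx]|[k _ Gx]]; [exists k.*2|exists k.*2.+1] => //=;
    rewrite odd_double /= ?uphalf_double ?doubleK.
by move=> [k _]; case: ifP => _ kx; [right|left]; exists k./2.
Qed.

Section ComeagerClass.
Context (R : realType) (X : ptopologicalType) (K : set (probability (borel X) R)).
Context (N : nat -> nat) (c : nat -> X -> nat).
Hypotheses (cpt : compact [set: X]) (co : coords N c) (Nlt : forall n, n < N n).
Context (mu : probability (borel X) R) (Kmu : K mu).
Hypothesis mu_pos : forall A : set X, clopen A -> A !=set0 -> (0 < msr mu A)%R.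
Context (g : GKstar K).
Hypothesis g_comeager : comeager (conj_class g).

(** The conjugates of [g] by maps that turn [A] into the clopen set described by
    [q]. *)
Definition carried (A : set X) (q : X -> bool) : set (GKstar K) :=
  fun f : GKstar K => exists2 h : GK K, val f = (h * val g * h^-1)%g &
    forall x, A x <-> q (h x).

(** The comeager class of [g] is a countable union of sets [carried A q]. *)
Lemma carried_somewhere_dense A : clopen A ->
  exists m (s : seq nat), ~ nowhere_dense (carried A (fun x => c m x \in s)).
Proof.
move=> cA; apply: contrapT => nex.
have carried_nd m (s : seq nat) : nowhere_dense (carried A (fun x => c m x \in s)).
  by apply: contrapT => nd; apply: nex; exists m, s.
have mC : meager (conj_class g).
  exists (fun k => if unpickle k is Some p then
    carried A (fun x => c p.1 x \in (p.2 : seq nat)) else set0); split.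
    move=> k; case: unpickle => [[m s]|]; first exact: carried_nd.
    by rewrite /nowhere_dense closure0 interior0.
  apply/seteqP; split=> f [h].
    move=> fE; have /(co_clopen cpt co)[m mA] := homeo_clopen (homeo_sym h) cA.
    pose s := [seq i <- iota 0 (N m) | `[< exists y, c m y = i /\ A (homeo_inv h y) >]].
    exists (pickle (m, s)) => //; rewrite pickleK; exists h => // x /=.
    rewrite mem_filter mem_iota /= (co_lt co) andbT; split=> [Ax|/asboolP[y [e Ay]]].
      by apply/asboolP; exists (h x); rewrite homeoK.
    by have := mA _ _ e Ay; rewrite /= homeoK.
  by move=> _; case: unpickle => // -[m s] [h' fE _]; exists h'.
apply: (@GKstar_baire R X K N c cpt co).
  by exists (val g); apply: set_mem; exact: (valP g).
by rewrite -(setUv (conj_class g)); exact: meagerU.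
Qed.

(** Conjugation transports the statistics of [A] under [g], so they depend neither
    on [f] nor on [q]. *)
Lemma carried_pattern A m (q : X -> bool) (f : GKstar K) L (W : nat -> bool) :
  (forall x y, c m x = c m y -> q x = q y) -> carried A q f ->
  msr mu (pattern_set (val f)^-1%g q L W) =
  msr mu [set x | forall i, i < L -> `[< A (iter i (homeo_inv (val g)) x) >] = W i].
Proof.
move=> qm [h fE hA].
have bP : borelset (pattern_set (val f)^-1%g q L W).
  exact: (pattern_borelset cpt co (val f)^-1%g L W qm).
rewrite -(GK_msr h Kmu bP); congr (msr mu _).
apply/seteqP; split=> x xW i iL; rewrite -(xW i iL) -[iter i (val f)^-1%g _]/(iter i (homeo_inv (val f)) _) fE conj_iterV homeoK.
  by apply/asboolP/idP => /hA.
by apply/idP/asboolP => /hA.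
Qed.

(** Around some member [f] of a somewhere dense set [carried A q], every map is
    approximated by members, and the frequency of a pattern is locally constant:
    the conjugates of [f] near [f] all have the statistics of [A] under [g]. *)
Lemma carried_periodic A : clopen A ->
  exists2 p, 0 < p & forall x, A (iter p (val g) x) <-> A x.
Proof.
move=> /carried_somewhere_dense[m [s nd]]; set q := fun x => c m x \in s in nd.
have qm x y : c m x = c m y -> q x = q y by rewrite /q => ->.
have [f0 [n dn]] : exists (f : GKstar K) n, forall g' : GKstar K,
    coincide c n (val f) (val g') -> forall a, exists2 h : GKstar K,
    coincide c a (val g') (val h) & carried A q h.
  apply: contrapT => nex; apply: nd; apply/(nowhere_denseP cpt co) => f n.
  apply: contrapT => nn; apply: nex; exists f, n => g' fg' a.
  apply: contrapT => na; apply: nn; exists g', a; split=> // h gh Ah.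
  by apply: na; exists h.
have [f f0f fA] := dn f0 (coincide_refl c n (val f0)) n.
pose F : GK K := (val f)^-1%g; pose l := maxn n m.
have ql x y : c l x = c l y -> q x = q y.
  by move=> e; apply: qm; exact: (co_coarse co (leq_maxr n m) e).
have F_noinv (U : set X) : clopen U -> U !=set0 -> F @^-1` U = U -> U = setT.
  move=> cU U0 FU; apply: contrapT => UT.
  by have /set_mem/(_ U cU U0 UT) := valP f; apply; rewrite homeo_image.
have pat (t : GK K) : (forall z, c l (t (F z)) = c l (F (t z))) -> forall L W,
    msr mu [set z | forall i, i < L -> q (t (iter i F z)) = W i] =
    msr mu (pattern_set F q L W).
  move=> tF L W.
  pose f2 : GKstar K := exist (fun u => u \in GKstar K) _ (mem_set (@conj_GKstar _ _ K f t)).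
  have f02 : coincide c n (val f0) (val f2).
    apply: coincide_trans f0f _ => x; apply: (co_coarse co (leq_maxl n m)).
    rewrite -[homeo_inv (val f2) x]/(t (F (homeo_inv t x))) tF.
    by rewrite homeoVK.
  have [a aP] := coincide_iterV cpt co m L (val f2).
  have [f3 f23 f3A] := dn f2 f02 a.
  rewrite (carried_pattern L W qm fA) -(carried_pattern L W qm f3A).
  have -> : pattern_set (val f3)^-1%g q L W = pattern_set (val f2)^-1%g q L W.
    have e32 i x : i < L -> q (iter i (homeo_inv (val f3)) x) = q (iter i (homeo_inv (val f2)) x).
      by move=> iL; apply: qm; exact: (aP _ f23 _ _ (ltnW iL)).
    by apply/seteqP; split=> x xW i iL; rewrite -xW //; [apply/esym|]; exact: e32.
  have bP : borelset (pattern_set (val f2)^-1%g q L W).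
    exact: (pattern_borelset cpt co (val f2)^-1%g L W qm).
  rewrite -(GK_msr t Kmu bP); congr (msr mu _).
  apply/seteqP; split=> x xW i iL; rewrite -(xW i iL);
    by rewrite -[val f2]/(t * val f * t^-1)%g conj_iterV homeoK.
have [p p0 pP] := constant_patterns_periodic cpt co Nlt Kmu mu_pos F_noinv ql pat.
have [h fE hA] := fA; exists p => // x.
have := pP (h (iter p (val g) x)).
rewrite -[iter p F _]/(iter p (homeo_inv (val f)) _) fE conj_iterV homeoK iter_homeoK => e.
by split=> /hA; [rewrite -e|rewrite e] => /hA.
Qed.

Lemma comeager_periodic l : exists2 p, 0 < p & forall x, c l (iter p (val g) x) = c l x.
Proof.
have /choice[p pP] : forall i, exists p, 0 < p /\
    forall x, c l (iter p (val g) x) = i <-> c l x = i.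
  move=> i; have [p p0 pP] := carried_periodic (co_clopen_cell cpt co l i).
  by exists p.
exists (\prod_(i < N l) p i).
  by rewrite prodn_gt0 // => i; case: (pP i).
move=> x; set i := c l x; have [_ pi] := pP i.
have /dvdnP[d ->] : p i %| \prod_(i < N l) p i.
  by rewrite (bigD1 (Ordinal (co_lt co l x))) //= dvdn_mulr.
by rewrite iterM; elim: d => [//|d IH] /=; exact/pi.
Qed.
End ComeagerClass.

(** * The main theorem *)

Theorem theorem4p5 (R : realType) (X : ptopologicalType)
    (K : set (probability (borel X) R)) :
  is_cantor_space X -> dynamical_simplex K ->
  ((exists g : GKstar K, comeager (conj_class g)) <->
   (exists mu : probability (borel X) R,
      K = [set nu : probability (borel X) R | measure_eq nu mu] /\
      exists g : X -> X, is_odometer g /\ unique_invariant_measure g mu)) /\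
  (forall (mu : probability (borel X) R) (g : X -> X),
     K = [set nu : probability (borel X) R | measure_eq nu mu] ->
     is_odometer g -> unique_invariant_measure g mu ->
     exists g' : GKstar K,
       (val g' : X -> X) = g /\ comeager (conj_class g')).
Proof.
move=> cantorX [K0 _ convK regK _].
have [cpt [c co]] := cantor_coords cantorX.
have Nlt n : n < radix (fun=> 2) n by exact: ltn_radix.
split=> [|mu g KE og [gmu _]]; last exact: unique_odometer_comeager KE og gmu.
split=> [[g comg]|[mu [KE [g [og [gmu _]]]]]]; last first.
  by have [g' [_ comg']] := unique_odometer_comeager cpt KE og gmu; exists g'.
have [mu Kmu] := K0.
have mu_pos (A : set X) : clopen A -> A !=set0 -> (0 < msr mu A)%R.
  move=> cA A0; rewrite -lte_fin -msrE; last exact: clopen_borelset.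
  by case: (regK mu Kmu) => _; apply => //; case: cA.
have per := comeager_periodic cpt co Nlt Kmu mu_pos comg.
have [M [d [cd sd]]] := periodic_coords cpt co per.
have [k k2 [e ce se]] := steps_radix point cd (co_unbounded cpt Nlt co cd) sd.
have [nu KE nuU] := steps_simplex_singleton cpt ce se K0 convK.
exists nu; split=> //; exists (val g : GK K); split=> //.
exact: steps_odometer cpt k2 ce se.
Qed.
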